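(* Every finite subgroup $H<\mathcal G$ is cyclic. Moreover, after conjugation, $H$ transitively permutes the vertices of a simplex $\sigma\subset X(\mathcal G)$ that contains $*$, and $H$ has one of the following two forms: Type 1: the order of $H$ is even, say $2m$; $H$ is generated by (the image of) an atom $B$; the vertices of $\sigma$ are (the cosets of) $*,B,B^2,\dots,B^{m-1}$, all of which are atoms, and $B^m=\Delta$; necessarily $\overline B=B$. Type 2: the order $m$ of $H$ is odd; $H$ is generated by $B\Delta$ for an atom $B$; the vertices of $\sigma$ are (the cosets of) the $m$ alternating products $*,B,B\overline B,B\overline BB,\dots,(B\overline B)^{(m-1)/2}$ (all atoms), which are permuted cyclically and faithfully by $H$ (so $\sigma$ has dimension $m-1$), and $(B\overline B)^{(m-1)/2}B=\Delta$. Since $m$ is odd, $B\overline B$, the square of the generator, also generates $H$.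
   Context: Let $\mathcal A$ be an Artin group of finite type with generating set $S$ and associated finite Coxeter group $\mathcal W$; $\mathcal A^+$ is the submonoid generated by $S$, and $x<y$ means $y=xz$ with $z\in\mathcal A^+$. An atom is an element of $\mathcal A^+$ whose $S$-word length equals the length of its image in $\mathcal W$; $\Delta$ is the atom mapping to the longest element of $\mathcal W$; $\Delta^2$ is central and $\bar x=\Delta x\Delta^{-1}$ is an involution of $\mathcal A$ preserving atoms. For $g\in\mathcal A^+$, $\alpha(g)$ is the largest (for $<$) atom with $\alpha(g)<g$; the normal form of $g$ is $g=A_1\cdot\ldots\cdot A_k$ with nontrivial atoms and $A_i=\alpha(A_i\cdots A_k)$. Let $\mathcal G=\mathcal A/\langle\Delta^2\rangle$ act on $V=\mathcal A/\langle\Delta\rangle$ by left multiplication, $*=\langle\Delta\rangle$. Each $v\in V$ has a unique special representative in $\mathcal A^+$ whose normal form contains no $\Delta$; $|v|$ is its number of atoms and $d_{at}(v,w)=|g^{-1}w|$ for $g( * )=v$. $X(\mathcal G)$ is the simplicial complex on $V$ whose simplices are finite vertex sets pairwise at $d_{at}=1$; $\mathcal G$ acts on it simplicially. *)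

(* Defs.v *)
(* Artin groups of finite type, presented concretely by
   words in the generators and their inverses modulo the congruence generated
   by the defining relations (a setoid presentation of the group). *)
From mathcomp Require Import all_boot.
From mathcomp Require Import ssralg ssrint.
Set Implicit Arguments. Unset Strict Implicit. Unset Printing Implicit Defensive.

Section ArtinDefs.
Variable S : finType.

(* a letter (s, true) is the generator s, (s, false) is s^-1 *)
Definition word := seq (S * bool).

Definition pos (w : word) : bool := all snd w.
Definition winv (w : word) : word := rev (map (fun x => (x.1, ~~ x.2)) w).

Definition altw (x y : word) (n : nat) : word :=
  flatten (mkseq (fun i => if odd i then y else x) n).

Definition wpow (w : word) (k : int) : word :=
  match k with
  | Posz n => flatten (nseq n w)
  | Negz n => flatten (nseq n.+1 (winv w))
  end.

Inductive cong (R : word -> word -> Prop) : word -> word -> Prop :=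
| cong_refl x : cong R x x
| cong_sym x y : cong R x y -> cong R y x
| cong_trans x y z : cong R x y -> cong R y z -> cong R x z
| cong_step u v x y : R x y -> cong R (u ++ x ++ v) (u ++ y ++ v).

Definition free_rel (x y : word) : Prop :=
  exists s b, x = [:: (s, b); (s, ~~ b)] /\ y = [::].
Definition braid_rel (m : S -> S -> nat) (x y : word) : Prop :=
  exists s t, s != t /\ x = altw [:: (s, true)] [:: (t, true)] (m s t)
                     /\ y = altw [:: (t, true)] [:: (s, true)] (m s t).
Definition cox_rel (x y : word) : Prop :=
  exists s, x = [:: (s, true); (s, true)] /\ y = [::].

Definition coxeter_matrix (m : S -> S -> nat) : Prop :=
  (forall s, m s s = 1) /\ (forall s t, m s t = m t s) /\
  (forall s t, s != t -> 2 <= m s t).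

Definition aeq m := cong (fun x y => free_rel x y \/ braid_rel m x y).
Definition weq m := cong (fun x y => free_rel x y \/ braid_rel m x y \/ cox_rel x y).

Definition finite_type (m : S -> S -> nat) : Prop :=
  exists L : seq word, forall w, exists2 u, u \in L & weq m w u.

Definition cox_length m (w : word) (n : nat) : Prop :=
  (exists u, size u = n /\ weq m u w) /\ (forall u, weq m u w -> n <= size u).

Definition in_Apos m (g : word) : Prop := exists w, pos w /\ aeq m g w.

Definition ple m (x y : word) : Prop := exists z, in_Apos m z /\ aeq m y (x ++ z).

Definition atom m (a : word) : Prop :=
  exists w, pos w /\ aeq m a w /\ cox_length m w (size w).

Definition is_Delta m (d : word) : Prop :=
  exists w, pos w /\ aeq m d w /\ cox_length m w (size w) /\
    (forall u n, cox_length m u n -> n <= size w).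

Definition bar (d x : word) : word := d ++ x ++ winv d.

Definition is_alpha m (g a : word) : Prop :=
  atom m a /\ ple m a g /\ (forall c, atom m c -> ple m c g -> ple m c a).

Definition normal_form m (g : word) (As : seq word) : Prop :=
  (forall A, A \in As -> atom m A /\ ~ aeq m A [::]) /\
  aeq m g (flatten As) /\
  (forall i, i < size As -> is_alpha m (flatten (drop i As)) (nth [::] As i)).

Definition geq m (d : word) :=
  cong (fun x y => free_rel x y \/ braid_rel m x y \/ (x = d ++ d /\ y = [::])).

(* equality of vertices in V = A / <Delta> (left cosets); the vertex
   represented by x is x<Delta>, and * is represented by [::] *)
Definition veq m (d x y : word) : Prop := exists k : int, aeq m y (x ++ wpow d k).

Definition special_rep m d (v p : word) (As : seq word) : Prop :=
  veq m d v p /\ normal_form m p As /\ (forall A, A \in As -> ~ aeq m A d).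

Definition dat1 m d (v w : word) : Prop :=
  exists g p As, veq m d g v /\ special_rep m d (winv g ++ w) p As /\ size As = 1.

Definition simplex m d (sigma : seq word) : Prop :=
  forall v w, v \in sigma -> w \in sigma -> ~ veq m d v w -> dat1 m d v w.

Definition subgroupG m d (H : word -> Prop) : Prop :=
  (forall x y, H x -> geq m d x y -> H y) /\ H [::] /\
  (forall x y, H x -> H y -> H (x ++ y)) /\ (forall x, H x -> H (winv x)).

Definition has_order m d (H : word -> Prop) (n : nat) : Prop :=
  exists L : seq word, size L = n /\ (forall x, x \in L -> H x) /\
    (forall i j, i < n -> j < n -> i != j -> ~ geq m d (nth [::] L i) (nth [::] L j)) /\
    (forall x, H x -> exists2 y, y \in L & geq m d x y).

Definition finite_subgroup m d H : Prop := exists n, has_order m d H n.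

Definition generates m d (H : word -> Prop) (g : word) : Prop :=
  H g /\ forall h, H h -> exists k : int, geq m d h (wpow g k).

Definition cyclicG m d (H : word -> Prop) : Prop := exists g, generates m d H g.

Definition conjG (c : word) (H : word -> Prop) : word -> Prop :=
  fun x => H (winv c ++ x ++ c).

Definition vertices_are m d (sigma : seq word) (f : nat -> word) (n : nat) : Prop :=
  (forall v, v \in sigma -> exists2 i, i < n & veq m d v (f i)) /\
  (forall i, i < n -> exists2 v, v \in sigma & veq m d v (f i)).

Definition type1 m d (H : word -> Prop) (sigma : seq word) (n : nat) : Prop :=
  exists k B, n = (2 * k)%N /\ atom m B /\ generates m d H B /\
    vertices_are m d sigma (fun i => wpow B i) k /\
    (forall i, i < k -> atom m (wpow B i)) /\
    aeq m (wpow B k) d /\ aeq m (bar d B) B.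

Definition type2 m d (H : word -> Prop) (sigma : seq word) (n : nat) : Prop :=
  exists B, odd n /\ atom m B /\ generates m d H (B ++ d) /\
    let P := altw B (bar d B) in
    vertices_are m d sigma P n /\
    (forall i, i < n -> atom m (P i)) /\
    (forall i j, i < n -> j < n -> i != j -> ~ veq m d (P i) (P j)) /\
    (forall i, i < n -> veq m d ((B ++ d) ++ P i) (P (i.+1 %% n))) /\
    aeq m (P n) d /\
    generates m d H (B ++ bar d B).

End ArtinDefs.

(* Main.v *)
(* Order the Artin group A by x <= y iff x^-1 y is positive.  This is a lattice order,
   preserved by left translations and by right multiplication by Delta, and the
   atoms are the elements of the interval [1, Delta].

   Degree and torsion-freeness make the preimage of a finite subgroup H in A
   infinite cyclic, generated by some g with g^n = Delta^2, n = |H|.  If n = 2k, the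
   lattice automorphism x |-> g^k x Delta^-1 is an involution; if n = 2j + 1,
   sigma : x |-> g^(j+1) x Delta^-1 is an n-th root of right multiplication by Delta.
   The meet y of a suitable finite orbit satisfies y <= g y and g^k y = y Delta,
   respectively y <= sigma y; hence B = y^-1 g y, respectively
   B = y^-1 g^(j+1) y Delta^-1, is positive, and B^k = Delta, respectively
   B bar(B) B ... = Delta (n factors).

   The lattice property follows Michel: the action of A^+ on pairs (simple element,
   rest) yields cancellation and the fact that common right multiples of two
   generators s, t are multiples of the alternating product s t s ... of length
   m s t.  Newman's lemma turns this local statement into the existence of meets,
   both for the weak order on the Coxeter group and for A. *)
From HB Require Import structures.
Require Import Defs.
From mathcomp Require Import all_boot.
From mathcomp Require Import order ssralg ssrnum ssrint generic_quotient.
From mathcomp Require Import poly algC cyclotomic ring zify.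
From mathcomp Require Import boolp.

Set Implicit Arguments. Unset Strict Implicit. Unset Printing Implicit Defensive.
Local Open Scope quotient_scope.
Local Open Scope group_scope.

(** * Monoids presented by a congruence on words *)

Section PresentedMonoid.
Variable T : choiceType.

Record congr := Congr {
  crel :> seq T -> seq T -> Prop;
  crel_refl : forall x, crel x x;
  crel_sym : forall x y, crel x y -> crel y x;
  crel_trans : forall x y z, crel x y -> crel y z -> crel x z;
  crel_cat : forall x y u v, crel x y -> crel u v -> crel (x ++ u) (y ++ v) }.

Variable R : congr.

Let relb (x y : seq T) : bool := `[< R x y >].
Let relb_refl : reflexive relb. Proof. by move=> x; apply/asboolP/crel_refl. Qed.
Let relb_sym : symmetric relb.
Proof. by move=> x y; apply/asboolP/asboolP; apply: crel_sym. Qed.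
Let relb_trans : transitive relb.
Proof.
by move=> y x z /asboolP xy /asboolP yz; apply/asboolP/(crel_trans xy).
Qed.

Definition pmon_equiv := EquivRel relb relb_refl relb_sym relb_trans.
Definition pmon := {eq_quot pmon_equiv}.
HB.instance Definition _ := Choice.on pmon.
HB.instance Definition _ := EqQuotient.on pmon.

Definition cls (x : seq T) : pmon := \pi_pmon x.

Lemma clsP x y : cls x = cls y <-> R x y.
Proof.
split=> [/eqP|xy]; first by rewrite eqmodE => /asboolP.
by apply/eqP; rewrite eqmodE; apply/asboolP.
Qed.

Lemma cls_surj (a : pmon) : exists x, a = cls x.
Proof. by exists (repr a); rewrite /cls reprK. Qed.

Definition pmon_mul (a b : pmon) : pmon := cls (repr a ++ repr b).

Lemma pmon_mulE x y : pmon_mul (cls x) (cls y) = cls (x ++ y).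
Proof. by apply/clsP/crel_cat; apply/clsP; rewrite /cls reprK. Qed.

Fact pmon_mulA : associative pmon_mul.
Proof.
move=> a b c; have [[x ->] [y ->]] := (cls_surj a, cls_surj b).
have [z ->] := cls_surj c; by rewrite !pmon_mulE catA.
Qed.
Fact pmon_mul1 : left_id (cls [::]) pmon_mul.
Proof. by move=> a; have [x ->] := cls_surj a; rewrite pmon_mulE. Qed.
Fact pmon_1mul : right_id (cls [::]) pmon_mul.
Proof. by move=> a; have [x ->] := cls_surj a; rewrite pmon_mulE cats0. Qed.

HB.instance Definition _ := isMonoid.Build pmon pmon_mulA pmon_mul1 pmon_1mul.

Lemma cls_cat x y : cls (x ++ y) = cls x * cls y.
Proof. by rewrite -pmon_mulE. Qed.

End PresentedMonoid.

(** * Congruences on words with inverses and their restriction to positive words *)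

Section Congruences.
Variables (S : finType) (R : word S -> word S -> Prop).

Lemma cong_ctx u v x y : cong R x y -> cong R (u ++ x ++ v) (u ++ y ++ v).
Proof.
elim=> {x y} [x|x y _ IH|x y z _ IH1 _ IH2|u' v' x y Rxy].
- exact: cong_refl.
- exact: cong_sym.
- exact: cong_trans IH1 IH2.
rewrite -!catA (catA u u') (catA u u') -!catA.
by rewrite (catA u u' (x ++ _)) (catA u u' (y ++ _)); apply: cong_step.
Qed.

Lemma cong_cat x y u v : cong R x y -> cong R u v -> cong R (x ++ u) (y ++ v).
Proof.
move=> xy uv; apply: (@cong_trans _ _ _ (y ++ u)).
  exact: (cong_ctx [::] u xy).
by have := cong_ctx y [::] uv; rewrite !cats0.
Qed.

Lemma cong_rel x y : R x y -> cong R x y.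
Proof. by move=> Rxy; have := cong_step [::] [::] Rxy; rewrite /= !cats0. Qed.

(** The universal property in the form used throughout: when letters act on a set by [f], only the
    defining relations have to be checked for congruent words to act alike. *)
Lemma cong_foldr (X : Type) (f : S * bool -> X -> X) :
    (forall x y, R x y -> forall z, foldr f z x = foldr f z y) ->
  forall x y, cong R x y -> forall z, foldr f z x = foldr f z y.
Proof.
move=> Rf x y; elim=> {x y} // [x y z _ IH1 _ IH2 t|u v x y Rxy z].
  by rewrite IH1.
by rewrite !foldr_cat (Rf _ _ Rxy).
Qed.

Definition cong_congr : congr (S * bool)%type :=
  Congr (@cong_refl _ R) (@cong_sym _ R) (@cong_trans _ R) cong_cat.

Definition emb (u : seq S) : word S := map (fun s => (s, true)) u.

Lemma map_fst_emb u : map fst (emb u) = u.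
Proof. by rewrite -map_comp map_id. Qed.

Lemma emb_map_fst w : pos w -> emb (map fst w) = w.
Proof. by elim: w => //= -[s []] w IH //= /IH ->. Qed.

Lemma pos_emb u : pos (emb u).
Proof. by rewrite /pos /emb all_map; apply/allP. Qed.

Lemma embS_cat x y u v : cong R (emb x) (emb y) -> cong R (emb u) (emb v) ->
  cong R (emb (x ++ u)) (emb (y ++ v)).
Proof. by rewrite /emb !map_cat; apply: cong_cat. Qed.

(** Positive words suffice for the Coxeter group, whose generators are involutions; with the braid
    relations alone they give the monoid of positive braids. *)
Definition pos_congr : congr S :=
  @Congr S (fun u v => cong R (emb u) (emb v)) (fun u => cong_refl R (emb u))
    (fun u v => @cong_sym _ R (emb u) (emb v))
    (fun u v w => @cong_trans _ R (emb u) (emb v) (emb w)) embS_cat.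

End Congruences.

Lemma cong_sub (S : finType) (R R' : word S -> word S -> Prop) :
    (forall x y, R x y -> cong R' x y) ->
  forall x y, cong R x y -> cong R' x y.
Proof.
move=> sub x y; elim=> {x y} [x|x y _ IH|x y z _ IH1 _ IH2|u v x y /sub Rxy].
- exact: cong_refl.
- exact: cong_sym.
- exact: cong_trans IH1 IH2.
exact: cong_ctx.
Qed.

(** * Alternating words and pairs of involutions *)

Section AlternatingWords.
Variable S : Type.

Fixpoint alt (s t : S) (n : nat) : seq S :=
  if n is n'.+1 then s :: alt t s n' else [::].

Lemma size_alt s t n : size (alt s t n) = n.
Proof. by elim: n s t => //= n IH s t; rewrite IH. Qed.

Lemma alt_add s t a b :
  alt s t (a + b) = alt s t a ++ (if odd a then alt t s b else alt s t b).
Proof. by elim: a s t => //= a IH s t; rewrite IH; case: (odd a). Qed.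

Lemma alt_rcons s t n : alt s t n.+1 = rcons (alt s t n) (if odd n then t else s).
Proof.
by rewrite -addn1 alt_add -cats1; case: (odd n).
Qed.

Lemma rev_alt s t n : rev (alt s t n) = if odd n then alt s t n else alt t s n.
Proof.
elim: n s t => // n IH s t; rewrite [in LHS]alt_rcons rev_rcons IH /=.
by case: (odd n).
Qed.

Section Involutions.
Variables (X : Type) (f : S -> X -> X).
Hypothesis fK : forall s, involutive (f s).

Lemma foldr_rev u x : foldr f (foldr f x u) (rev u) = x.
Proof.
by elim: u => //= s u IH; rewrite rev_cons -cats1 foldr_cat /= fK.
Qed.

Lemma foldr_alt_double s t n x : foldr f x (alt s t n.*2) = iter n (f s \o f t) x.
Proof. by elim: n => //= n ->. Qed.

(** For involutions a reversed word acts as the inverse, and [alt s t n] followed by the reverse of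
    [alt t s n] is [alt s t n.*2], which acts as [n] rounds of [f s \o f t]. *)
Lemma foldr_braid s t n : iter n (f s \o f t) =1 id ->
  forall x, foldr f x (alt s t n) = foldr f x (alt t s n).
Proof.
move=> fn x; set y := foldr f x (alt t s n).
have <- : foldr f y (rev (alt t s n)) = x by rewrite /y foldr_rev.
rewrite rev_alt -foldr_cat.
by rewrite -alt_add addnn foldr_alt_double fn.
Qed.

End Involutions.
End AlternatingWords.

Lemma altwE (S : finType) (x y : word S) n :
  altw x y n = flatten (alt x y n).
Proof.
rewrite /altw /mkseq; congr flatten.
have : forall k, [seq (if odd i then y else x) | i <- iota k n] =
    if odd k then alt y x n else alt x y n.
  by elim: n => [|n IH] k /=; rewrite ?IH /=; case: (odd k).
by move=> ->.
Qed.

Lemma altw_emb (S : finType) (s t : S) n :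
  altw [:: (s, true)] [:: (t, true)] n = emb (alt s t n).
Proof. by rewrite altwE; elim: n s t => //= n IH s t; rewrite IH. Qed.

(** * The Coxeter group, the braid monoid and the Artin group as quotients *)

Section Presentations.
Variables (S : finType) (m : S -> S -> nat).

Definition cox_grp := pmon (pos_congr (fun x y => free_rel x y \/ braid_rel m x y \/ cox_rel x y)).
HB.instance Definition _ := Monoid.on cox_grp.
Definition braid_mon := pmon (pos_congr (braid_rel m)).
HB.instance Definition _ := Monoid.on braid_mon.
Definition artin_grp := pmon (cong_congr (fun x y => free_rel x y \/ braid_rel m x y)).
HB.instance Definition _ := Monoid.on artin_grp.

Local Notation W := cox_grp.
Local Notation M := braid_mon.
Local Notation A := artin_grp.

Definition wev (u : seq S) : W := cls _ u.
Definition mev (u : seq S) : M := cls _ u.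
Definition aev (u : word S) : A := cls _ u.

Lemma wevP u v : wev u = wev v <-> weq m (emb u) (emb v).
Proof. exact: clsP. Qed.
Lemma mevP u v : mev u = mev v <-> cong (braid_rel m) (emb u) (emb v).
Proof. exact: clsP. Qed.
Lemma aevP u v : aev u = aev v <-> aeq m u v.
Proof. exact: clsP. Qed.

Lemma wev_surj (a : W) : exists u, a = wev u. Proof. exact: cls_surj. Qed.
Lemma mev_surj (a : M) : exists u, a = mev u. Proof. exact: cls_surj. Qed.
Lemma aev_surj (a : A) : exists u, a = aev u. Proof. exact: cls_surj. Qed.

Lemma wev_nil : wev [::] = 1. Proof. by []. Qed.
Lemma aev_nil : aev [::] = 1. Proof. by []. Qed.

Lemma wev_cat u v : wev (u ++ v) = wev u * wev v. Proof. exact: cls_cat. Qed.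
Lemma mev_cat u v : mev (u ++ v) = mev u * mev v. Proof. exact: cls_cat. Qed.
Lemma aev_cat u v : aev (u ++ v) = aev u * aev v. Proof. exact: cls_cat. Qed.

Lemma wev_cons s u : wev (s :: u) = wev [:: s] * wev u.
Proof. by rewrite -wev_cat. Qed.
Lemma mev_cons s u : mev (s :: u) = mev [:: s] * mev u.
Proof. by rewrite -mev_cat. Qed.
Lemma aev_cons s u : aev (s :: u) = aev [:: s] * aev u.
Proof. by rewrite -aev_cat. Qed.

Lemma wev_gen2 s : wev [:: s] * wev [:: s] = 1.
Proof.
rewrite -wev_cat -wev_nil; apply/wevP/cong_rel; right; right.
by exists s.
Qed.

Lemma wev_rev u : wev (rev u) * wev u = 1.
Proof.
elim: u => [|s u IH]; first by rewrite mulg1.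
rewrite rev_cons -cats1 wev_cat -mulgA (wev_cons s u) (mulgA (wev [:: s])).
by rewrite wev_gen2 mul1g.
Qed.

Lemma mev_braid s t : s != t -> mev (alt s t (m s t)) = mev (alt t s (m s t)).
Proof.
move=> st; apply/mevP/cong_rel; exists s, t.
by rewrite !altw_emb.
Qed.

Lemma wev_braid s t : s != t -> wev (alt s t (m s t)) = wev (alt t s (m s t)).
Proof.
move=> st; apply/wevP/cong_rel; right; left; exists s, t.
by rewrite !altw_emb.
Qed.

Lemma aev_free s b : aev [:: (s, b)] * aev [:: (s, ~~ b)] = 1.
Proof.
rewrite -aev_cat -aev_nil; apply/aevP/cong_rel; left.
by exists s, b.
Qed.

Lemma winv_cons (x : S * bool) u : winv (x :: u) = winv u ++ [:: (x.1, ~~ x.2)].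
Proof. by rewrite /winv /= rev_cons cats1. Qed.

Lemma aev_winvr u : aev u * aev (winv u) = 1.
Proof.
elim: u => [|[s b] u IH]; first by rewrite mulg1.
rewrite winv_cons aev_cat (aev_cons _ u) -!mulgA (mulgA (aev u)) IH mul1g.
exact: aev_free.
Qed.

Lemma aev_winvl u : aev (winv u) * aev u = 1.
Proof.
elim: u => [|[s b] u IH]; first by rewrite mulg1.
rewrite winv_cons aev_cat (aev_cons _ u) -!mulgA (mulgA (aev [:: _])).
by have := aev_free s (~~ b); rewrite negbK => ->; rewrite mul1g.
Qed.

Definition cox_inv (a : W) : W := wev (rev (repr a)).
Definition artin_inv (a : A) : A := aev (winv (repr a)).

Lemma wev_repr (a : W) : wev (repr a) = a. Proof. by rewrite /wev /cls reprK. Qed.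
Lemma aev_repr (a : A) : aev (repr a) = a. Proof. by rewrite /aev /cls reprK. Qed.

Fact cox_mulVg : left_inverse 1 cox_inv *%g.
Proof. by move=> a; rewrite -{2}(wev_repr a) wev_rev. Qed.
Fact cox_mulgV : right_inverse 1 cox_inv *%g.
Proof.
by move=> a; rewrite -{1}(wev_repr a) -[X in wev X * _]revK wev_rev.
Qed.
HB.instance Definition _ := hasInv.Build cox_grp cox_inv.
HB.instance Definition _ := Monoid_isGroup.Build cox_grp cox_mulVg cox_mulgV.

Fact artin_mulVg : left_inverse 1 artin_inv *%g.
Proof. by move=> a; rewrite -{2}(aev_repr a) aev_winvl. Qed.
Fact artin_mulgV : right_inverse 1 artin_inv *%g.
Proof. by move=> a; rewrite -{1}(aev_repr a) aev_winvr. Qed.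
HB.instance Definition _ := hasInv.Build artin_grp artin_inv.
HB.instance Definition _ := Monoid_isGroup.Build artin_grp artin_mulVg artin_mulgV.

Lemma wev_inv u : (wev u)^-1 = wev (rev u).
Proof. by apply: (mulIg (wev u)); rewrite wev_rev mulVg. Qed.
Lemma aev_inv u : (aev u)^-1 = aev (winv u).
Proof. by apply: (mulIg (aev u)); rewrite aev_winvl mulVg. Qed.
Lemma wev_genV s : (wev [:: s])^-1 = wev [:: s].
Proof. exact: wev_inv. Qed.

Lemma braid_mon_foldr (X : Type) (f : S -> X -> X) :
    (forall s t, s != t -> forall x,
       foldr f x (alt s t (m s t)) = foldr f x (alt t s (m s t))) ->
  forall u v, mev u = mev v -> forall x, foldr f x u = foldr f x v.
Proof.
move=> fB u v /mevP uv x.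
have E w z : foldr (fun a : S * bool => f a.1) z (emb w) = foldr f z w.
  by elim: w => //= s w ->.
rewrite -2!E; move: uv x; apply: cong_foldr => _ _ [s [t [st [-> ->]]]] z.
by rewrite !altw_emb !E fB.
Qed.

Lemma cox_grp_foldr (X : Type) (f : S -> X -> X) :
    (forall s, involutive (f s)) ->
    (forall s t, s != t -> iter (m s t) (f s \o f t) =1 id) ->
  forall u v, wev u = wev v -> forall x, foldr f x u = foldr f x v.
Proof.
move=> fK fB u v /wevP uv x.
have E w z : foldr (fun a : S * bool => f a.1) z (emb w) = foldr f z w.
  by elim: w => //= s w ->.
rewrite -2!E; move: uv x; apply: cong_foldr => x y [|[]] [s].
- by move=> [b [-> ->]] z /=; rewrite fK.
- move=> [t [st [-> ->]]] z.
  by rewrite !altw_emb !E; apply: foldr_braid (fB _ _ st) _.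
by move=> [-> ->] z /=; rewrite fK.
Qed.

Lemma cox_grp_power s t : s != t -> (wev [:: s] * wev [:: t]) ^+ m s t = 1.
Proof.
move=> st.
have E n : (wev [:: s] * wev [:: t]) ^+ n = wev (alt s t n.*2).
  elim: n => // n IH; rewrite expgS IH doubleS /= (wev_cons s (t :: _)) (wev_cons t (alt _ _ _)).
  by rewrite mulgA.
rewrite E -addnn alt_add.
have -> : (if odd (m s t) then alt t s (m s t) else alt s t (m s t)) =
   rev (alt t s (m s t)) by rewrite rev_alt.
by rewrite wev_cat (wev_braid st) -wev_inv mulgV.
Qed.

End Presentations.

(** * A representation in which s t has order exactly m s t *)

Section NumbersGame.
Import GRing.Theory.
Local Open Scope ring_scope.
Variables (S : finType) (m : S -> S -> nat).
Hypothesis cm : coxeter_matrix m.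

(** Only the order of the root matters, so some primitive [2n]-th root of unity is chosen; at
    [n = 0] the order defaults to 1. *)
Definition root2 (n : nat) : algC := sval (C_prim_root_exists (ltn0Sn n.*2.-1)).

Lemma root2_prim n : (0 < n)%N -> (n.*2).-primitive_root (root2 n).
Proof. by case: n => // n _; rewrite /root2; case: C_prim_root_exists. Qed.

(** For [r <> s] these are Galois conjugates of the entries [- 2 cos (pi / m)] of the geometric
    representation. *)
Definition cartan (r s : S) : algC :=
  if r == s then 2%:R else - (root2 (m r s) + (root2 (m r s))^-1).

(** The reflection [s] in the contragredient of the geometric representation, known as a move of the
    numbers game. *)
Definition fire (s : S) (x : S -> algC) : S -> algC :=
  fun r => x r - cartan r s * x s.

Lemma fireK s : involutive (fire s).
Proof. by move=> x; apply: funext => r; rewrite /fire /cartan eqxx; ring. Qed.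

Section TwoNodes.
Variables s t : S.
Hypothesis st : s != t.
Let z := root2 (m s t).
Let w := z ^+ 2.

Let mgt1 : (1 < m s t)%N. Proof. by case: cm => _ [_]; apply. Qed.
Let z_prim : (m s t).*2.-primitive_root z.
Proof. exact/root2_prim/ltnW. Qed.
Let z_neq0 : z != 0.
Proof.
apply/eqP=> z0; have := prim_expr_order z_prim.
by rewrite z0 expr0n double_eq0; case: (m s t) mgt1 => // n _ /eqP; rewrite eq_sym oner_eq0.
Qed.
Let wX k : (w ^+ k == 1) = (m s t %| k)%N.
Proof. by rewrite -exprM -(prim_order_dvd z_prim) -muln2 mulnC dvdn_pmul2l. Qed.
Let w_neq1 : w - 1 != 0.
Proof.
by rewrite subr_eq0 -[w]expr1 wX dvdn1; case: (m s t) mgt1 => [|[]].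
Qed.

(* The two eigenvectors of [fire s \o fire t] in the plane of [s] and [t] have
   coordinates a, b; x holds the values at the other nodes. *)
Definition two_nodes (a b : algC) (x : S -> algC) : S -> algC :=
  fun r => if r == t then a + b else if r == s then - (a / z + b * z) else x r.

Lemma two_nodesP x : exists a b, x = two_nodes a b x.
Proof.
have zz : z - z^-1 != 0.
  have -> : z - z^-1 = (w - 1) / z by rewrite /w; field.
  by rewrite mulf_neq0 ?invr_eq0.
pose a := (x s + z * x t) / (z - z^-1).
exists a, (x t - a); apply: funext => r; rewrite /two_nodes.
case: eqP => [->|_]; first by rewrite addrC subrK.
case: eqP => // ->.
have : a * (z - z^-1) = x s + z * x t by rewrite /a mulfVK.
move: a => a E; apply/eqP; rewrite -subr_eq0 opprK; apply/eqP.
have -> : x s + (a / z + (x t - a) * z) = x s + z * x t - a * (z - z^-1) by ring.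
by rewrite E subrr.
Qed.

(** On the plane, [fire s \o fire t] has eigenvalues [w] and [1 / w] with [w] of order [m s t]; the
    other nodes only accumulate contributions from it. *)
Lemma fire_two_nodes a b x : fire s (fire t (two_nodes a b x)) =
  two_nodes (a * w) (b / w)
    (fun r => x r - cartan r t * (a + b) - cartan r s * (a * z + b / z)).
Proof.
case: cm => _ [msym _]; apply: funext => r; rewrite /fire /two_nodes /=.
rewrite /cartan !eqxx (negbTE st) -/z.
have [-> {r}|rt] := eqVneq r t.
  by rewrite eq_sym (negbTE st) msym -/z /w; field.
have [->|rs] := eqVneq r s; last by rewrite !opprD; ring.
by rewrite -/z /w; field.
Qed.

Lemma iter_two_nodes i a b x : iter i (fire s \o fire t) (two_nodes a b x) =
  two_nodes (a * w ^+ i) (b * w^-1 ^+ i)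
    (fun r => x r - cartan r t * (a * (\sum_(j < i) w ^+ j) + b * (\sum_(j < i) w^-1 ^+ j))
       - cartan r s * (a * z * (\sum_(j < i) w ^+ j) + b / z * (\sum_(j < i) w^-1 ^+ j))).
Proof.
elim: i => [|i IH].
  rewrite !big_ord0 !expr0 !mulr1 /=; congr two_nodes.
  by apply: funext => r; rewrite !mulr0 !addr0 !mulr0 !subr0.
rewrite iterS IH /= fire_two_nodes !big_ord_recr /= !exprSr.
rewrite !mulrA; congr two_nodes; apply: funext => r.
by ring.
Qed.

Lemma fire_braid : iter (m s t) (fire s \o fire t) =1 id.
Proof.
(* After [m s t] rounds the contributions to the other nodes are multiples of geometric sums over a
   root of unity other than 1, hence vanish. *)
have sum0 (v : algC) : v ^+ m s t = 1 -> v - 1 != 0 -> \sum_(j < m s t) v ^+ j = 0.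
  move=> vm v1; apply: (mulfI v1).
  by rewrite -subrX1 vm subrr mulr0.
have wm : w ^+ m s t = 1 by apply/eqP; rewrite wX.
have Vwm : w^-1 ^+ m s t = 1 by rewrite exprVn wm invr1.
move=> x; have [a [b E]] := two_nodesP x; rewrite {1}E iter_two_nodes wm Vwm.
rewrite !sum0 //; last by rewrite subr_eq0 invr_eq1 -subr_eq0.
rewrite !mulr1 !mulr0 !addr0 [RHS]E; congr two_nodes.
by apply: funext => r; rewrite !mulr0 !subr0.
Qed.

Lemma iter_fire_id k : iter k (fire s \o fire t) =1 id -> (m s t %| k)%N.
Proof.
move=> /(_ (two_nodes 1 0 (fun=> 0)))/(congr1 (@^~ t)).
rewrite iter_two_nodes /two_nodes eqxx mul1r mul0r !addr0 => /eqP.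
by rewrite wX.
Qed.

End TwoNodes.

End NumbersGame.

(** * The exchange condition and Matsumoto's theorem *)

Lemma cat_eq_cons (T : Type) (u v p q : seq T) (x : T) : u ++ v = p ++ x :: q ->
  (exists r, u = p ++ x :: r) \/ (exists r, p = u ++ r).
Proof.
elim: u p => [|y u IH] [|z p] /=; try by right; exists [::].
- by right; exists (z :: p).
- by case=> -> _; left; exists u.
by case=> -> /IH [[r ->]|[r ->]]; [left | right]; exists r.
Qed.

Section CoxeterGroup.
Variables (S : finType) (m : S -> S -> nat).
Hypothesis cm : coxeter_matrix m.
Local Notation W := (cox_grp m).
Local Notation M := (braid_mon m).
Local Notation wev := (wev m).
Local Notation mev := (mev m).
Implicit Types (s t : S) (u v p q : seq S) (a b c : W).

Definition gen s : W := wev [:: s].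

Lemma wevS s u : wev (s :: u) = gen s * wev u. Proof. exact: wev_cons. Qed.
Lemma gen2 s : gen s * gen s = 1. Proof. exact: wev_gen2. Qed.
Lemma mulg_genK s a : a * gen s * gen s = a.
Proof. by rewrite -mulgA gen2 mulg1. Qed.
Lemma genV s : (gen s)^-1 = gen s. Proof. exact: wev_genV. Qed.
Lemma genK s : involutive (mul (gen s)).
Proof. by move=> a; rewrite mulgA gen2 mul1g. Qed.

(** An equality would give [(s t)^k = 1], whereas [fire] shows that [m s t] divides every such
    exponent. *)
Lemma wev_alt_exact s t k : s != t -> 0 < k < m s t ->
  wev (alt s t k) <> wev (alt t s k).
Proof.
move=> st /andP[k0 km] E.
suff : m s t %| k by move/(dvdn_leq k0); lia.
apply: (iter_fire_id cm st) => x; rewrite -foldr_alt_double.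
suff : wev (alt s t k.*2) = wev [::].
  move/(cox_grp_foldr (@fireK S m)) => -> // s' t' st'.
  exact: fire_braid.
rewrite -addnn alt_add wev_cat E.
have -> : (if odd k then alt t s k else alt s t k) = rev (alt t s k).
  by rewrite rev_alt.
by rewrite -wev_inv mulgV.
Qed.

Definition wlen a : nat :=
  ex_minn (let: ex_intro u E := wev_surj a in
    ex_intro (fun n => `[< exists u, size u = n /\ wev u = a >]) (size u)
      (asboolT (ex_intro _ u (conj erefl (esym E))))).

Lemma wlen_le u : wlen (wev u) <= size u.
Proof.
rewrite /wlen; case: ex_minnP => n _; apply; apply/asboolP; by exists u.
Qed.

Lemma wlenP a : exists u, size u = wlen a /\ wev u = a.
Proof. by rewrite /wlen; case: ex_minnP => n /asboolP. Qed.

Definition reduced u := size u == wlen (wev u).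

Lemma reduced_ex a : exists u, reduced u /\ wev u = a.
Proof.
by have [u [su ua]] := wlenP a; exists u; rewrite /reduced ua su.
Qed.

Lemma reducedI u a : wev u = a -> size u <= wlen a -> reduced u.
Proof. by move=> <- le; rewrite /reduced eqn_leq le wlen_le. Qed.

Lemma wlen1 : wlen 1 = 0.
Proof. by apply/eqP; rewrite -leqn0; exact: (wlen_le [::]). Qed.

Lemma wlen_eq0 a : wlen a = 0 -> a = 1.
Proof. by move=> a0; have [u []] := wlenP a; rewrite a0; case: u => // _ <-. Qed.

Lemma wlenM a b : wlen (a * b) <= wlen a + wlen b.
Proof.
have [u [<- {1}<-]] := wlenP a; have [v [<- {1}<-]] := wlenP b.
by rewrite -wev_cat -size_cat wlen_le.
Qed.

Lemma wlenV_le a : wlen a^-1 <= wlen a.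
Proof.
by have [u [<- <-]] := wlenP a; rewrite wev_inv -(size_rev u) wlen_le.
Qed.

Lemma wlenV a : wlen a^-1 = wlen a.
Proof. by apply/eqP; rewrite eqn_leq wlenV_le -{1}(invgK a) wlenV_le. Qed.

Lemma wlen_gen_le s : wlen (gen s) <= 1. Proof. exact: (wlen_le [:: s]). Qed.

Lemma reduced_cat u v : reduced (u ++ v) -> reduced u /\ reduced v.
Proof.
rewrite /reduced size_cat wev_cat.
have := wlenM (wev u) (wev v); have := wlen_le u; have := wlen_le v.
lia.
Qed.

Lemma reduced_catE u v : reduced u -> reduced v ->
  reduced (u ++ v) = (wlen (wev u * wev v) == wlen (wev u) + wlen (wev v)).
Proof.
rewrite /reduced size_cat wev_cat; lia.
Qed.

(* The action of W on reflections with signs; its second component counts, modulo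
   2, the positions where a word crosses the wall of the reflection. *)
Definition refl_act s (x : W * bool) : W * bool :=
  (gen s * x.1 * gen s, x.2 (+) (x.1 == gen s)).

Lemma refl_actK s : involutive (refl_act s).
Proof.
move=> [a b]; rewrite /refl_act /=.
have -> : (gen s * a * gen s == gen s) = (a == gen s).
  apply/eqP/eqP => [E|->]; last by rewrite gen2 mul1g.
  have /mulg1_eq <- : gen s * a = 1 by apply: (mulIg (gen s)); rewrite E mul1g.
  exact: genV.
by rewrite -addbA addbb addbF !mulgA gen2 mul1g -mulgA gen2 mulg1.
Qed.

(** The [2k] letters test [a] against the successive reflections [t (s t)^i], [i < 2k], because
    conjugation by [t] inverts [s t]. *)
Lemma refl_act_iter s t k a (b : bool) :
  iter k (refl_act s \o refl_act t) (a, b) =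
  ((gen s * gen t) ^+ k * a * (gen s * gen t) ^- k,
   b (+) odd (count (fun i => a == gen t * (gen s * gen t) ^+ i) (iota 0 k.*2))).
Proof.
have [c Ec] : exists c, c = gen s * gen t by eexists.
rewrite -Ec; have ct i : c ^- i * gen t = gen t * c ^+ i.
  rewrite -expVgn Ec invgM !genV.
  elim: i => [|i IH]; first by rewrite mulg1 mul1g.
  by rewrite expgS -mulgA IH [in RHS]expgS !mulgA.
elim: k => [|k IH].
  by rewrite /= addbF mul1g invg1 mulg1.
rewrite iterS IH doubleS -addn2 iotaD count_cat add0n /refl_act /=.
have conjE x : (c ^+ k * a * c ^- k == x) = (a == c ^- k * x * c ^+ k).
  apply/eqP/eqP => [<-|->]; first by rewrite !mulgA mulVg mul1g mulgVK.
  by rewrite !mulgA mulgV mul1g mulgK.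
have E0 : (c ^+ k * a * c ^- k == gen t) = (a == gen t * c ^+ k.*2).
  by rewrite conjE ct -mulgA -expgnDr addnn.
have E1 : (gen t * (c ^+ k * a * c ^- k) * gen t == gen s) =
    (a == gen t * c ^+ k.*2.+1).
  have -> : (gen t * (c ^+ k * a * c ^- k) * gen t == gen s) =
     (c ^+ k * a * c ^- k == gen t * c).
    have -> : gen t * c = gen t * gen s * gen t by rewrite Ec mulgA.
    apply/eqP/eqP => [<-|->]; by rewrite !mulgA gen2 mul1g mulg_genK.
  by rewrite conjE mulgA ct -!mulgA -expgS -expgnDr addnS addnn.
congr pair.
  have cV : c^-1 = gen t * gen s by rewrite Ec invgM !genV.
  by rewrite expgS invgM cV {3}Ec !mulgA.
rewrite E0 E1 addn0 !oddD !oddb.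
by rewrite !addbA.
Qed.

(** Since [(s t)^m = 1], the [2m] reflections tested run twice through the same list, so each sign
    changes an even number of times. *)
Lemma refl_act_braid s t : s != t -> iter (m s t) (refl_act s \o refl_act t) =1 id.
Proof.
move=> st [a b]; rewrite refl_act_iter /gen cox_grp_power // mul1g invg1 mulg1.
congr pair; rewrite -addnn iotaD count_cat add0n oddD.
set P := fun i => _.
have -> : count P (iota (m s t) (m s t)) = count P (iota 0 (m s t)).
  rewrite -[in iota (m s t)](addn0 (m s t)) iotaDl count_map.
  by apply: eq_count => i /=; rewrite /P expgnDr cox_grp_power // mul1g.
by rewrite addbb addbF.
Qed.

Lemma refl_act_fst u x : (foldr refl_act x u).1 = wev u * x.1 * (wev u)^-1.
Proof.
elim: u => [|s u IH] /=; first by rewrite invg1 mulg1 mul1g.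
by rewrite IH wevS invgM genV !mulgA.
Qed.

Lemma refl_act_snd u a (b : bool) : (foldr refl_act (a, b) u).2 =
  b (+) (foldr refl_act (a, false) u).2.
Proof.
elim: u => [|s u IH] /=; first by rewrite addbF.
by rewrite IH !refl_act_fst addbA.
Qed.

(** For [u = x_1 x_2 ...] this is the parity of the number of [i] with
    [s x_1 ... x_(i-1) = x_1 ... x_i]; the reversal lets the first letter act first. *)
Definition crossed s u := (foldr refl_act (gen s, false) (rev u)).2.

Lemma crossed_wev s u v : wev u = wev v -> crossed s u = crossed s v.
Proof.
move=> uv; rewrite /crossed.
have /(cox_grp_foldr refl_actK refl_act_braid) -> // : wev (rev u) = wev (rev v).
by rewrite -!wev_inv uv.
Qed.

Lemma crossed_cons s u : crossed s (s :: u) = ~~ crossed s u.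
Proof.
rewrite /crossed rev_cons -cats1 foldr_cat [foldr _ _ [:: s]]/=.
have -> : refl_act s (gen s, false) = (gen s, true).
  by rewrite /refl_act /= eqxx gen2 mul1g.
by rewrite refl_act_snd.
Qed.

Lemma crossed_exchange s u : crossed s u ->
  exists p x q, u = p ++ x :: q /\ gen s * wev p = wev p * gen x.
Proof.
rewrite /crossed -{2}(revK u); elim: (rev u) => //= x r IH.
rewrite rev_cons -cats1.
case: (boolP (foldr _ _ r).2) => [/IH [p [y [q [-> E]]]] _|_].
  by exists p, y, (q ++ [:: x]); rewrite -catA.
rewrite addFb refl_act_fst => /eqP E; exists (rev r), x, [::].
by rewrite -E -wev_inv !mulgA mulVg mul1g.
Qed.

Lemma wev_delete s p x q : gen s * wev p = wev p * gen x ->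
  gen s * wev (p ++ x :: q) = wev (p ++ q).
Proof.
by move=> E; rewrite !wev_cat wevS mulgA E -!mulgA genK.
Qed.

Definition ldesc s a := wlen (gen s * a) < wlen a.

(** [crossed] depends only on the element, so a shortest word may be taken; a crossing lets one of
    its letters be deleted. *)
Lemma crossed_wlen s u : crossed s u -> wlen (gen s * wev u) < wlen (wev u).
Proof.
have [v [<- vu]] := wlenP (wev u); rewrite -(crossed_wev _ vu) -vu.
move=> /crossed_exchange [p [x [q [-> /wev_delete E]]]]; rewrite E.
by apply: leq_ltn_trans (wlen_le _) _; rewrite !size_cat /=; lia.
Qed.

(** Prepending [s] flips [crossed], so exactly one of [u] and [s :: u] is crossed, and it represents
    the longer element. *)
Lemma ldesc_crossed s u : ldesc s (wev u) = crossed s u.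
Proof.
rewrite /ldesc; case: (boolP (crossed s u)) => [/crossed_wlen -> //|].
by rewrite -crossed_cons => /crossed_wlen; rewrite wevS genK; lia.
Qed.

Lemma wlen_gen_succ s a : wlen (gen s * a) <= (wlen a).+1.
Proof. by have := wlenM (gen s) a; have := wlen_gen_le s; lia. Qed.

Lemma ldescN s a : ~~ ldesc s a -> wlen (gen s * a) = (wlen a).+1.
Proof.
have [u ->] := wev_surj a; rewrite ldesc_crossed -crossed_cons => /crossed_wlen.
by have := wlen_gen_succ s (wev u); rewrite wevS genK; lia.
Qed.

Lemma exchange s u : ldesc s (wev u) ->
  exists p x q, u = p ++ x :: q /\ gen s * wev p = wev p * gen x.
Proof. by rewrite ldesc_crossed; apply: crossed_exchange. Qed.

Lemma ldesc_reduced_cons s u : reduced (s :: u) -> ldesc s (wev (s :: u)).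
Proof.
rewrite /reduced /ldesc wevS genK /= => /eqP <-.
by have := wlen_le u; lia.
Qed.

Lemma reduced_cons s u : reduced u -> ~~ ldesc s (wev u) -> reduced (s :: u).
Proof. by move=> /eqP ru /ldescN; rewrite /reduced /= wevS => ->; rewrite ru. Qed.

Lemma alt_prefix s t k p x q : alt s t k = p ++ x :: q ->
  p ++ [:: x] = alt s t (size p).+1 /\ size p < k.
Proof.
move=> E; have lt : size p < k by rewrite -(size_alt s t k) E size_cat /=; lia.
split=> //; have := congr1 (take (size p).+1) E.
rewrite -{1}(subnKC lt) alt_add take_cat size_alt ltnn subnn take0 cats0 => ->.
by rewrite take_cat ltnNge leqnSn /= subSnn /= take0.
Qed.

(** An equality [t p = p x] would identify the two alternating words of length [size p + 1], which
    is below [m s t]. *)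
Lemma alt_not_ldesc s t k p x q : s != t -> k < m s t ->
  alt s t k = p ++ x :: q -> gen t * wev p <> wev p * gen x.
Proof.
case: cm => _ [msym _] st km /alt_prefix [E lt] F.
have : wev (alt t s (size p).+1) = wev (alt s t (size p).+1).
  rewrite -E wev_cat -F [alt t s _]/= wevS; congr (_ * wev _).
  have := congr1 (take (size p)) E; rewrite take_size_cat // => ->.
  by rewrite alt_rcons -cats1 take_size_cat ?size_alt.
apply: wev_alt_exact; rewrite 1?eq_sym // msym; lia.
Qed.

Lemma reduced_alt s t k : s != t -> k <= m s t -> reduced (alt s t k).
Proof.
case: cm => _ [msym _].
elim: k s t => [|k IH] s t st km; first by rewrite /reduced wlen1.
apply: reduced_cons; first by apply: IH; rewrite 1?eq_sym // msym ltnW.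
apply/negP => /exchange [p [x [q [E F]]]].
by apply: alt_not_ldesc E F; rewrite 1?eq_sym // msym.
Qed.

(** Exchanging [s] into [alt t s k ++ v] cannot delete a letter of the alternating part when
    [k < m s t], so it shortens [v] and the alternating prefix grows by one letter. *)
Lemma ldesc_alt s t a k : s != t -> ldesc s a -> ldesc t a -> k <= m s t ->
  exists v, reduced (alt s t k ++ v) /\ wev (alt s t k ++ v) = a.
Proof.
case: cm => _ [msym _].
elim: k s t => [|k IH] s t st sa ta km.
  exact: reduced_ex.
have ts : t != s by rewrite eq_sym.
have km' : k < m t s by rewrite msym.
have [v [rv Ev]] := IH t s ts ta sa (ltnW km').
have : ldesc s (wev (alt t s k ++ v)) by rewrite Ev.
move=> /[dup] sd /exchange [p [x [q [E F]]]].
have [[r Er]|[r Er]] := cat_eq_cons E.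
  by case: (alt_not_ldesc ts km' Er F).
have Ev' : wev (alt s t k.+1 ++ (r ++ q)) = a.
  by rewrite /= wevS catA -Er -(wev_delete _ F) -E genK.
exists (r ++ q); split=> //; apply: reducedI Ev' _.
have := congr1 size E; have := congr1 size Er; move: rv; rewrite /reduced Ev.
by rewrite /= !size_cat /= !size_alt; lia.
Qed.

(** If the first letters [s] and [t] differ, the element also has a reduced word beginning with the
    alternating word of length [m s t]. Induction compares each tail with it, and one braid relation
    joins the two halves. *)
Theorem matsumoto u v : reduced u -> reduced v -> wev u = wev v -> mev u = mev v.
Proof.
have [n] := ubnP (size u); elim: n u v => // n IH [|s u] [|t v] // un ru rv E.
- by move: rv; rewrite /reduced -E wlen1.
- by move: ru; rewrite /reduced E wlen1.
have [_ ru'] := @reduced_cat [:: s] u ru.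
have [_ rv'] := @reduced_cat [:: t] v rv.
have [st|st] := eqVneq s t.
  move: E; rewrite -st !wevS => /(mulgI (gen s)) E.
  by rewrite [LHS]mev_cons [RHS]mev_cons (IH _ _ _ ru' rv' E).
have sd := ldesc_reduced_cons ru; have td := ldesc_reduced_cons rv.
rewrite -E in td.
have [w [rw Ew]] := ldesc_alt st sd td (leqnn _).
case: cm => _ [msym mge2]; have := mge2 _ _ st; case Em : (m s t) => [//|k] _.
have Ew' : wev (alt t s k.+1 ++ w) = wev (s :: u).
  rewrite -Ew !wev_cat; congr (_ * _).
  by rewrite -Em wev_braid.
have rw' : reduced (alt t s k.+1 ++ w).
  by rewrite /reduced Ew' -Ew -(eqP rw) !size_cat !size_alt Em.
have su := eqP ru; have sv := eqP rv; rewrite -E in sv.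
have -> : mev (s :: u) = mev (alt s t k.+1 ++ w).
  rewrite mev_cons [in RHS]/= [RHS]mev_cons (IH u (alt t s k ++ w)) //.
  - by move: rw; rewrite Em => /(@reduced_cat [:: s]) [].
  - by move: Ew; rewrite Em /= !wevS => /(mulgI (gen s)).
have -> : mev (t :: v) = mev (alt t s k.+1 ++ w).
  rewrite mev_cons [in RHS]/= [RHS]mev_cons (IH v (alt s t k ++ w)) //.
  - by move: su sv un => /=; lia.
  - by move: rw' => /(@reduced_cat [:: t]) [].
  - by move: Ew'; rewrite E /= !wevS => /(mulgI (gen t)).
by rewrite !mev_cat -Em mev_braid.
Qed.

End CoxeterGroup.

(** * The weak order and cancellation in the braid monoid *)

Section Newman.
Variables (E : Type) (r : E -> E -> Prop) (mu : E -> nat).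

Inductive reach (x : E) : E -> Prop :=
| reach_refl : reach x x
| reach_step y z : r x y -> reach y z -> reach x z.

Lemma reach_trans x y z : reach x y -> reach y z -> reach x z.
Proof. by elim=> // {}x y' z' xy _ IH /IH; apply: reach_step. Qed.

Hypothesis mu_decr : forall x y, r x y -> mu y < mu x.
Hypothesis local_confluence : forall x y z, r x y -> r x z ->
  exists2 w, reach y w & reach z w.

(** Used with [r] as appending a generator while staying below two given elements: the common end
    point is then the greatest of their lower bounds above [z]. *)
Lemma newman z : exists2 n, reach z n & forall x, reach z x -> reach x n.
Proof.
have [k] := ubnP (mu z); elim: k z => // k IH z zk.
have [[y zy]|nz] := pselect (exists y, r z y); last first.
  exists z => [|x zx]; first exact: reach_refl.
  by case: zx nz => [_|y x' zy _ []]; [apply: reach_refl | exists y].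
have top y' : r z y' -> exists2 n, reach y' n & forall x, reach y' x -> reach x n.
  by move=> zy'; apply: IH; have := mu_decr zy'; lia.
have [n yn n_top] := top _ zy; exists n; first exact: reach_step yn.
move=> x zx; case: zx yn n_top => [yn _|y' x' zy' y'x' yn n_top].
  exact: reach_step yn.
have [n' y'n' n'_top] := top _ zy'.
have [w yw y'w] := local_confluence zy zy'.
have wn := n_top _ yw; have nn' := n'_top _ (reach_trans y'w wn).
apply: reach_trans (n'_top _ y'x') _.
exact/n_top/(reach_trans yn).
Qed.

End Newman.

(* Terms such as [a^-1 * b] may carry different, convertible canonical instances,
   which lia takes for different atoms; the generalization is up to conversion. *)
Ltac len_lia :=
  repeat match goal with
  | H : is_true ?P |- _ => match P with context [wlen _] => move: H end
  | H : @eq nat ?x ?y |- _ => match constr:(x + y) with context [wlen _] => move: H end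
  end;
  repeat match goal with |- context [wlen ?x] => move: (wlen x) => ? end; lia.

Section WeakOrder.
Variables (S : finType) (m : S -> S -> nat).
Hypothesis cm : coxeter_matrix m.
Local Notation W := (cox_grp m).
Local Notation M := (braid_mon m).
Local Notation wev := (wev m).
Local Notation mev := (mev m).
Local Notation gen := (@gen S m).
Implicit Types (s t : S) (u v p q : seq S) (a b c x y : W) (g h : M).

Definition wpre a b := wlen b == wlen a + wlen (a^-1 * b).

Lemma wpreI a b : wlen a + wlen (a^-1 * b) <= wlen b -> wpre a b.
Proof.
by have := wlenM a (a^-1 * b); rewrite mulVKg /wpre; len_lia.
Qed.

Lemma wpre_refl a : wpre a a.
Proof. by rewrite /wpre mulVg wlen1 addn0. Qed.

Lemma wpre1 a : wpre 1 a.
Proof. by rewrite /wpre invg1 mul1g wlen1. Qed.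

Lemma wpre_le a b : wpre a b -> wlen a <= wlen b.
Proof. by rewrite /wpre; len_lia. Qed.

Lemma wpre_trans b a c : wpre a b -> wpre b c -> wpre a c.
Proof.
move=> ab bc; apply: wpreI; have := wlenM (a^-1 * b) (b^-1 * c).
by rewrite -mulgA mulVKg; move: ab bc; rewrite /wpre; len_lia.
Qed.

Lemma wpre_anti a b : wpre a b -> wpre b a -> a = b.
Proof.
move=> ab ba; have /wlen_eq0/mulg1_eq : wlen (a^-1 * b) = 0.
  by move: ab ba; rewrite /wpre; len_lia.
by rewrite invgK.
Qed.

Lemma wpre_cat u v : reduced m (u ++ v) -> wpre (wev u) (wev (u ++ v)).
Proof.
move=> ruv; apply: wpreI; have := eqP ruv; rewrite wev_cat mulKg size_cat.
have := wlen_le m u; have := wlen_le m v; len_lia.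
Qed.

Lemma wpre_mull a x y : wpre a (a * x) -> wpre a (a * y) ->
  wpre (a * x) (a * y) = wpre x y.
Proof.
rewrite /wpre !mulKg invgM -mulgA mulKg; len_lia.
Qed.

Lemma wlen_gen1 s : wlen (gen s) = 1%N.
Proof. by have := @ldescN S m s 1; rewrite /ldesc wlen1 mulg1 => ->. Qed.

(** Both [s] and [t] are left descents of [x^-1 c], which therefore begins with a reduced
    alternating word of length [m s t]. This is local confluence for the search of meets. *)
Lemma wpre_alt x s t c : s != t -> wlen (x * gen s) = (wlen x).+1 ->
    wlen (x * gen t) = (wlen x).+1 -> wpre (x * gen s) c -> wpre (x * gen t) c ->
  wpre (x * wev (alt s t (m s t))) c /\
  wlen (x * wev (alt s t (m s t))) = wlen x + m s t.
Proof.
move=> st xs xt xsc xtc.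
have aux r : wlen (x * gen r) = (wlen x).+1 -> wpre (x * gen r) c ->
    ldesc r (x^-1 * c) /\ wpre x c.
  move=> xr xrc; have xxr : wpre x (x * gen r) by rewrite /wpre mulKg xr wlen_gen1 addn1.
  have xc := wpre_trans xxr xrc; split=> //; move: xc xrc.
  by rewrite /wpre /ldesc xr invgM genV -mulgA; len_lia.
have [sd xc] := aux _ xs xsc; have [td _] := aux _ xt xtc.
have [v [rv Ev]] := ldesc_alt cm st sd td (leqnn _).
set d := wev (alt s t (m s t)).
have Ec : x^-1 * c = d * wev v by rewrite -Ev wev_cat.
have dv : wlen (x^-1 * c) = m s t + wlen (wev v).
  have [_ /eqP rv'] := reduced_cat rv.
  by rewrite -Ev -(eqP rv) size_cat size_alt rv'.
have Ec' : (x * d)^-1 * c = wev v by rewrite invgM -mulgA Ec mulKg.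
have := wlenM x d; have := wlenM (x * d) (wev v).
rewrite -{1}Ec' mulVKg => le1 le2.
have := wlen_le m (alt s t (m s t)); rewrite size_alt -/d => le3.
split; last by move: xc; rewrite /wpre; len_lia.
by apply: wpreI; rewrite Ec'; move: xc; rewrite /wpre; len_lia.
Qed.

Section Meet.
Variables a b : W.

Let r x y := exists s, [/\ y = x * gen s, wlen y = (wlen x).+1, wpre y a & wpre y b].

Let reach_wpre x y : wpre x a -> wpre x b -> reach r x y ->
  [/\ wpre x y, wpre y a & wpre y b].
Proof.
move=> xa xb xy; elim: xy xa xb => {x y} [x|x _ z [s [-> xs xsa xsb]] _ IH] xa xb.
  by rewrite wpre_refl.
have [xsz za zb] := IH xsa xsb; split=> //; apply: wpre_trans xsz.
by rewrite /wpre mulKg xs wlen_gen1 addn1.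
Qed.

Let reach_word x u : wpre (x * wev u) a -> wpre (x * wev u) b ->
  wlen (x * wev u) = wlen x + size u -> reach r x (x * wev u).
Proof.
elim: u x => [|s u IH] x; first by rewrite mulg1 => *; apply: reach_refl.
rewrite wevS mulgA => xa xb /= E.
have le := wlenM (x * gen s) (wev u); have leu := wlen_le m u.
have lex := wlenM x (gen s); rewrite wlen_gen1 in lex.
have xs : wpre (x * gen s) (x * gen s * wev u) by apply: wpreI; rewrite mulKg; len_lia.
apply: (@reach_step _ _ _ (x * gen s)); last by apply: IH => //; len_lia.
exists s; split=> //; [len_lia | exact: wpre_trans xs xa | exact: wpre_trans xs xb].
Qed.

Let confl x y z : r x y -> r x z -> exists2 w, reach r y w & reach r z w.
Proof.
move=> [s [-> xs xsa xsb]] [t [-> xt xta xtb]].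
have [<-|st] := eqVneq s t; first by exists (x * gen s); apply: reach_refl.
have [wa wl] := wpre_alt st xs xt xsa xta.
have [wb _] := wpre_alt st xs xt xsb xtb.
have [_ [msym mge2]] := cm; have := mge2 _ _ st; case Em : (m s t) => [//|k] _.
rewrite Em in wa wb wl.
have E1 : x * wev (alt s t k.+1) = x * gen s * wev (alt t s k) by rewrite wevS mulgA.
have E2 : x * wev (alt s t k.+1) = x * gen t * wev (alt s t k).
  by rewrite -Em wev_braid // Em wevS mulgA.
exists (x * wev (alt s t k.+1)).
  by rewrite E1; apply: reach_word; rewrite -E1 // wl xs size_alt; lia.
by rewrite E2; apply: reach_word; rewrite -E2 // wl xt size_alt; lia.
Qed.

Lemma wmeet_ex : exists c, [/\ wpre c a, wpre c b &
  forall x, wpre x a -> wpre x b -> wpre x c].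
Proof.
have [|n n1 n_top] := newman (mu := fun x => wlen a - wlen x) _ confl 1.
  by move=> x y [s [-> xs /wpre_le]]; len_lia.
have [_ na nb] := reach_wpre (wpre1 a) (wpre1 b) n1.
exists n; split=> // x xa xb.
have [u [ru Eu]] := reduced_ex x.
have /n_top : reach r 1 x.
  rewrite -(mul1g x) -Eu; apply: reach_word; rewrite mul1g ?Eu //.
  by rewrite wlen1 add0n (eqP ru) Eu.
by case/(reach_wpre xa xb).
Qed.

Definition wmeet : W := sval (cid wmeet_ex).

Lemma wmeetl : wpre wmeet a. Proof. by rewrite /wmeet; case: cid => c [? ? ?]. Qed.
Lemma wmeetr : wpre wmeet b. Proof. by rewrite /wmeet; case: cid => c [? ? ?]. Qed.
Lemma wmeet_max x : wpre x a -> wpre x b -> wpre x wmeet.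
Proof. by rewrite /wmeet; case: cid => c [ca cb cmax]; apply: cmax. Qed.

End Meet.

(** By Matsumoto's theorem the lift does not depend on the reduced word chosen; its values are the
    simple elements. *)
Definition mlift a : M := mev (sval (cid (reduced_ex a))).

Lemma mlift_reduced u : reduced m u -> mlift (wev u) = mev u.
Proof. by rewrite /mlift => ru; case: cid => v /= [rv /(matsumoto cm) ->]. Qed.

Lemma mlift1 : mlift 1 = 1.
Proof. by rewrite -wev_nil mlift_reduced // /reduced wlen1. Qed.

Lemma mlift_gen s : mlift (gen s) = mev [:: s].
Proof. by rewrite mlift_reduced // /reduced wlen_gen1. Qed.

Lemma mliftM a b : wpre a (a * b) -> mlift (a * b) = mlift a * mlift b.
Proof.
have [u [ru <-]] := reduced_ex a; have [v [rv <-]] := reduced_ex b.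
rewrite /wpre mulKg -reduced_catE // => ruv.
by rewrite -wev_cat !mlift_reduced // mev_cat.
Qed.

Lemma mlift_wpre a b : wpre a b -> mlift b = mlift a * mlift (a^-1 * b).
Proof. by move=> ab; rewrite -mliftM mulVKg. Qed.

(** * Prefixes of the longest element and the action of the braid monoid on pairs *)

Section LongestElement.
Variable w0 : W.
Hypothesis w0_max : forall a, wlen a <= wlen w0.

Lemma ldesc_w0 s : ldesc s w0.
Proof. by apply/negPn/negP => /ldescN; have := w0_max (gen s * w0); len_lia. Qed.

(** With [s :: u] reduced and [w0 = u v], exchanging the descent [s] must delete a letter of [v],
    since one in [u] would shorten [s u]. So [s u] is again a prefix of [w0]. *)
Lemma wpre_w0 a : wpre a w0.
Proof.
have [u [ru <-]] := reduced_ex a; elim: u ru => [|s u IH] rsu; first exact: wpre1.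
have [_ ru] := @reduced_cat _ _ [:: s] u rsu.
have [v [rv Ev]] := reduced_ex ((wev u)^-1 * w0).
have Euv : wev (u ++ v) = w0 by rewrite wev_cat Ev mulVKg.
have suv : size u + size v = wlen w0.
  by have := IH ru; rewrite /wpre -Ev -(eqP ru) -(eqP rv) => /eqP.
have := ldesc_w0 s; rewrite -Euv => /exchange [p [x [q [E F]]]].
have [[r Er]|[r Er]] := cat_eq_cons E.
  have := wlen_le m (p ++ r); rewrite -(wev_delete _ F) -Er -wevS -(eqP rsu) Er.
  by rewrite /= !size_cat /=; lia.
have E0 : wev ((s :: u) ++ (r ++ q)) = w0.
  by rewrite cat_cons wevS catA -Er -(wev_delete _ F) -E genK.
rewrite Euv -E0; apply: wpre_cat; apply: reducedI E0 _.
have := congr1 size E; have := congr1 size Er.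
by rewrite /= !size_cat /=; len_lia.
Qed.

Lemma wlen_compl a : wlen w0 = wlen a + wlen (a^-1 * w0).
Proof. exact/eqP/wpre_w0. Qed.

Lemma w0V : w0^-1 = w0.
Proof.
have := wlen_compl w0^-1; rewrite wlenV invgK => E.
by apply/mulg1_eq/wlen_eq0; len_lia.
Qed.

Lemma wpre_compl a x : wpre x (a^-1 * w0) -> wpre a (a * x).
Proof.
move=> xa; apply: wpreI; rewrite mulKg; have := wlen_compl a.
have := wlenM (a * x) (x^-1 * (a^-1 * w0)).
by rewrite -!mulgA !mulVKg; move: xa; rewrite /wpre; len_lia.
Qed.

(* Left multiplication by a generator in A^+, seen on a pair (a, g) that stands
   for the product of the simple element a by g: a is cut at the largest prefix
   that stays simple. *)
Definition push s (x : W * M) : W * M :=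
  let a := wmeet ((gen s)^-1 * w0) x.1 in
  (gen s * a, mlift (a^-1 * x.1) * x.2).

(** Pushing the letters of a reduced word one by one amounts to a single cut at the largest prefix
    [b] of [a] with [u b] simple. The result depends only on the element, which yields the braid
    relations for [push]. *)
Lemma push_reduced u a g : reduced m u -> foldr push (a, g) u =
  let b := wmeet ((wev u)^-1 * w0) a in (wev u * b, mlift (b^-1 * a) * g).
Proof.
elim: u => [|s u IH] rsu.
  have -> /= : wmeet ((wev [::])^-1 * w0) a = a.
    apply: wpre_anti; first exact: wmeetr.
    by apply: wmeet_max (wpre_refl _); rewrite invg1 mul1g wpre_w0.
  by rewrite mul1g mulVg mlift1 mul1g.
have [_ ru] := @reduced_cat _ _ [:: s] u rsu.
rewrite /= IH //= /push /= wevS.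
set a1 := wmeet ((wev u)^-1 * w0) a; set b := wmeet ((gen s * wev u)^-1 * w0) a.
set x := wev u in IH a1 b *.
have lsx : wlen (gen s * x) = (wlen x).+1.
  by rewrite -wevS -(eqP rsu) /= (eqP ru).
(* The complements of [s x] and of [x] differ by a [w0]-conjugate of [s], which has length at most
   1. *)
have du : wpre ((gen s * x)^-1 * w0) (x^-1 * w0).
  apply: wpreI.
  have -> : ((gen s * x)^-1 * w0)^-1 * (x^-1 * w0) = w0^-1 * gen s * w0.
    by rewrite !invgM !invgK -!mulgA mulVKg.
  have : wlen (w0^-1 * gen s * w0) <= 1.
    have := wlen_compl (gen s); have := wlen_compl (gen s * w0).
    by rewrite invgM genV wlen_gen1; len_lia.
  have := wlen_compl (gen s * x); have := wlen_compl x; len_lia.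
have Es : (gen s)^-1 * w0 = x * ((gen s * x)^-1 * w0).
  by rewrite invgM -mulgA mulVKg.
have x_ds : wpre x ((gen s)^-1 * w0).
  by rewrite Es; apply: wpre_compl du.
have ba1 : wpre b a1 by apply: wmeet_max (wmeetr _ _); apply: wpre_trans (wmeetl _ _) du.
have xa1 : wpre x (x * a1) by apply: wpre_compl (wmeetl _ _).
have xb : wpre x (x * b) by apply: wpre_compl (wpre_trans (wmeetl _ _) du).
(* Cancelling [x] on both sides turns this meet into the one defining [b], since the complement of
   [s x] is a prefix of that of [x]. *)
have -> : wmeet ((gen s)^-1 * w0) (x * a1) = x * b.
  apply: wpre_anti.
    set c := wmeet _ _.
    have xc : wpre x c by apply: wmeet_max.
    rewrite -(mulVKg x c); rewrite wpre_mull ?mulVKg //.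
    apply: wmeet_max.
      by rewrite -(@wpre_mull x) ?mulVKg -?Es //; apply: wmeetl.
    apply: wpre_trans (wmeetr (x^-1 * w0) a); rewrite -/a1.
    by rewrite -(@wpre_mull x) ?mulVKg //; apply: wmeetr.
  apply: wmeet_max; last by rewrite wpre_mull.
  by rewrite Es wpre_mull -?Es // wmeetl.
rewrite mulgA; congr pair; rewrite mulgA; congr (_ * g).
rewrite invgM -mulgA mulKg (mlift_wpre (b := b^-1 * a) (a := b^-1 * a1)).
  by rewrite invgM invgK -mulgA mulVKg.
have ba : wpre b a by apply: wmeetr.
have a1a : wpre a1 a by apply: wmeetr.
apply: wpreI; rewrite invgM invgK -mulgA mulVKg.
by move: ba a1a ba1; rewrite /wpre; len_lia.
Qed.

Lemma push_braid s t : s != t -> forall x : W * M,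
  foldr push x (alt s t (m s t)) = foldr push x (alt t s (m s t)).
Proof.
move=> st [a g]; have [_ [msym _]] := cm.
rewrite !push_reduced ?wev_braid //; apply: reduced_alt => //.
- by rewrite eq_sym.
- by rewrite msym.
Qed.

Lemma push_mlift s a g : mlift (push s (a, g)).1 * (push s (a, g)).2 =
  mev [:: s] * (mlift a * g).
Proof.
rewrite /push /=; set b := wmeet _ _.
have ba : wpre b a := wmeetr _ _.
rewrite mliftM; last by apply: wpre_compl; apply: wmeetl.
by rewrite mlift_gen -!mulgA [mlift b * _]mulgA -(mlift_wpre ba).
Qed.

Lemma foldr_push_mlift u : mlift (foldr push (1, 1) u).1 * (foldr push (1, 1) u).2 = mev u.
Proof.
elim: u => [|s u IH] /=; first by rewrite mlift1 mulg1.
rewrite [in RHS]mev_cons -IH; case: (foldr _ _ u) => a g.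
exact: push_mlift.
Qed.

Lemma foldr_push_mev u v : mev u = mev v -> foldr push (1, 1) u = foldr push (1, 1) v.
Proof. by move=> uv; apply: (braid_mon_foldr push_braid uv). Qed.

(** The product before the push can be recovered: the first component reveals the cut [a1], and the
    lift of [a1] times the second component is that product. *)
Lemma mev_consI s u v : mev (s :: u) = mev (s :: v) -> mev u = mev v.
Proof.
move/foldr_push_mev; rewrite /= -(foldr_push_mlift u) -(foldr_push_mlift v).
case: (foldr _ _ u) => a g; case: (foldr _ _ v) => b h; rewrite /push /=.
set a1 := wmeet _ a; set b1 := wmeet _ b => -[/(mulgI (gen s)) ab gh].
have a1a : wpre a1 a := wmeetr _ _; have b1b : wpre b1 b := wmeetr _ _.
by rewrite (mlift_wpre a1a) (mlift_wpre b1b) -!mulgA gh ab.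
Qed.

Lemma braid_mon_mulI g : injective (mul g).
Proof.
have [u ->] := mev_surj g; elim: u => [|s u IH] h k; first by rewrite !mul1g.
have [v ->] := mev_surj h; have [w ->] := mev_surj k.
rewrite -!mev_cat /= => /mev_consI; rewrite !mev_cat; exact: IH.
Qed.

Lemma ldesc_push s (x : W * M) : ldesc s (push s x).1.
Proof.
rewrite /push /ldesc /= genK; set a := wmeet _ _.
have : wpre (gen s) (gen s * a) by apply: wpre_compl; apply: wmeetl.
by rewrite /wpre mulKg wlen_gen1; len_lia.
Qed.

(** The simple part of the common value, computed from either word, has both [s] and [t] as
    descents, so it begins with the alternating word of length [m s t]. *)
Lemma mev_cons_alt s t g h : s != t -> mev [:: s] * g = mev [:: t] * h ->
  exists k, mev [:: s] * g = mev (alt s t (m s t)) * k.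
Proof.
have [u ->] := mev_surj g; have [v ->] := mev_surj h; rewrite -!mev_cat /= => st.
move=> /foldr_push_mev E; rewrite -foldr_push_mlift.
have sd := ldesc_push s (foldr push (1, 1) u).
have td := ldesc_push t (foldr push (1, 1) v).
have E1 : push t (foldr push (1, 1) v) = push s (foldr push (1, 1) u) := esym E.
rewrite E1 in td; have [w [rw Ew]] := ldesc_alt cm st sd td (leqnn _).
exists (mev w * (foldr push (1, 1) (s :: u)).2).
have -> : (foldr push (1, 1) (s :: u)).1 = wev (alt s t (m s t) ++ w) by rewrite Ew.
by rewrite (mlift_reduced rw) mev_cat -mulgA.
Qed.

End LongestElement.

End WeakOrder.

(** * The lattice order on the Artin group *)

Section GarsideGroup.
Variables (S : finType) (m : S -> S -> nat).
Hypothesis cm : coxeter_matrix m.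
Local Notation W := (cox_grp m).
Local Notation M := (braid_mon m).
Local Notation A := (artin_grp m).
Local Notation wev := (wev m).
Local Notation mev := (mev m).
Local Notation aev := (aev m).
Local Notation gen := (@gen S m).

Lemma mev_wev u v : mev u = mev v -> wev u = wev v.
Proof.
move=> /mevP uv; apply/wevP; apply: cong_sub uv => x y xy.
by apply: cong_rel; right; left.
Qed.

Lemma mev_size u v : mev u = mev v -> size u = size v.
Proof.
have E w : foldr (fun=> succn) 0 w = size w by elim: w => //= s w ->.
move=> uv; rewrite -2!E; apply: (braid_mon_foldr _ uv) => s t _ n.
have F k s' t' : foldr (fun=> succn) n (alt s' t' k) = n + k.
  by elim: k s' t' => [|k IH] s' t' /=; rewrite ?addn0 // IH addnS.
by rewrite !F.
Qed.

Lemma mev_aev u v : mev u = mev v -> aev (emb u) = aev (emb v).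
Proof.
move=> /mevP uv; apply/aevP; apply: cong_sub uv => x y xy.
by apply: cong_rel; right.
Qed.

Variable w0 : W.
Hypothesis w0_max : forall a : W, wlen a <= wlen w0.

Implicit Types (g h k : M).

Definition Dlt : M := mlift w0.

Lemma mlift_compl a : mlift a * mlift (a^-1 * w0) = Dlt.
Proof. by rewrite -(mlift_wpre cm) //; apply: wpre_w0. Qed.

(** Taking the complement in [w0] twice is conjugation by [w0]. *)
Lemma mlift_Dlt a : mlift a * Dlt = Dlt * mlift (w0^-1 * a * w0).
Proof.
rewrite -{1}(mlift_compl (a^-1 * w0)) mulgA mlift_compl; congr (_ * mlift _).
by rewrite invgM invgK.
Qed.

Lemma Dlt_lift a : Dlt * mlift a = mlift (w0^-1 * a * w0) * Dlt.
Proof.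
rewrite mlift_Dlt; congr (_ * mlift _).
by rewrite !mulgA (w0V w0_max) -{1}(w0V w0_max) mulVg mul1g -mulgA
  -{1}(w0V w0_max) mulVg mulg1.
Qed.

Lemma mul_Dlt g : exists h, g * Dlt = Dlt * h.
Proof.
have [u ->] := mev_surj g; elim: u => [|s u [h IH]].
  by exists 1; rewrite mul1g mulg1.
exists (mlift (w0^-1 * gen s * w0) * h).
by rewrite mev_cons -mulgA IH mulgA -(mlift_gen cm) mlift_Dlt -!mulgA.
Qed.

Lemma Dlt_mul g : exists h, Dlt * g = h * Dlt.
Proof.
have [u ->] := mev_surj g; elim: u => [|s u [h IH]].
  by exists 1; rewrite mul1g mulg1.
exists (mlift (w0^-1 * gen s * w0) * h).
by rewrite mev_cons mulgA -(mlift_gen cm) Dlt_lift -mulgA IH mulgA.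
Qed.

Definition Dlt2 : M := Dlt * Dlt.

Lemma Dlt2C g : commute g Dlt2.
Proof.
have [u ->] := mev_surj g; elim: u => [|s u IH].
  by rewrite /commute mul1g mulg1.
rewrite /commute mev_cons -mulgA IH mulgA [RHS]mulgA; congr (_ * _).
by rewrite /Dlt2 -(mlift_gen cm) mulgA mlift_Dlt -mulgA -Dlt_lift mulgA.
Qed.

Lemma Dlt2XC g n : commute g (Dlt2 ^+ n).
Proof. exact/commuteX/Dlt2C. Qed.

(** For an inverse letter this is the positive element that becomes [s^-1 Delta^2] in the group. *)
Definition fpos (x : S * bool) : M :=
  if x.2 then mev [:: x.1] else mlift ((gen x.1)^-1 * w0) * Dlt.

(* The positive part of [w] once each inverse [s^-1] is written as a positive
   element times [Delta^-2]. *)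
Definition ppart (w : word S) : M := foldr (fun x => mul (fpos x)) 1 w.
Definition nneg (w : word S) : nat := count (fun x => ~~ x.2) w.

Lemma ppart_cat u v : ppart (u ++ v) = ppart u * ppart v.
Proof. by elim: u => [|x u IH] /=; rewrite ?mul1g // IH mulgA. Qed.

Lemma ppart_emb u : ppart (emb u) = mev u.
Proof. by elim: u => //= s u ->; rewrite [RHS]mev_cons. Qed.

Lemma nneg_emb u : nneg (emb u) = 0.
Proof. by elim: u. Qed.

Lemma fpos_neg s b : fpos (s, b) * fpos (s, ~~ b) = Dlt2.
Proof.
have E : mev [:: s] * (mlift ((gen s)^-1 * w0) * Dlt) = Dlt2.
  by rewrite mulgA -(mlift_gen cm) mlift_compl.
case: b => //; rewrite /fpos /= -mulgA -(mlift_gen cm) Dlt_lift mulgA.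
rewrite /Dlt2 -{2}(mlift_compl ((gen s)^-1 * w0)); congr (_ * mlift _ * _).
by rewrite invgM invgK.
Qed.

(** Fractions with powers of the central [Delta^2] as denominators are compared by
    cross-multiplication; transitivity is where cancellation in the monoid enters. *)
Lemma ppart_aeq w w' : aeq m w w' ->
  ppart w * Dlt2 ^+ nneg w' = ppart w' * Dlt2 ^+ nneg w.
Proof.
elim=> {w w'} // [x y z _ IH1 _ IH2|u v x y Rxy].
  apply: (braid_mon_mulI cm w0_max (g := Dlt2 ^+ nneg y)).
  rewrite !mulgA -(Dlt2XC (ppart x)) -(Dlt2XC (ppart z)) IH1 -mulgA.
  by rewrite (Dlt2XC (Dlt2 ^+ _)) mulgA IH2.
have E : ppart x * Dlt2 ^+ nneg y = ppart y * Dlt2 ^+ nneg x.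
  case: Rxy => [[s [b [-> ->]]]|[s [t [st [-> ->]]]]].
    rewrite /ppart /nneg /= !mulg1 fpos_neg mul1g.
    by case: b.
  by rewrite !altw_emb !ppart_emb !nneg_emb mev_braid.
have ctx x' y' : ppart (u ++ x' ++ v) * Dlt2 ^+ nneg (u ++ y' ++ v) =
    ppart u * (ppart x' * Dlt2 ^+ nneg y') * ppart v * Dlt2 ^+ (nneg u + nneg v).
  rewrite !ppart_cat /nneg !count_cat addnCA expgnDr -!mulgA.
  by congr (_ * (_ * _)); rewrite !mulgA (Dlt2XC (ppart v)).
by rewrite !ctx E.
Qed.

Theorem aev_mev u v : aev (emb u) = aev (emb v) -> mev u = mev v.
Proof. by move=> /aevP/ppart_aeq; rewrite !ppart_emb !nneg_emb !mulg1. Qed.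

Definition iotaA (g : M) : A := aev (emb (repr g)).

Lemma iota_mev u : iotaA (mev u) = aev (emb u).
Proof. by apply: mev_aev; rewrite /mev /cls reprK. Qed.

Lemma iotaM g h : iotaA (g * h) = iotaA g * iotaA h.
Proof.
have [[u ->] [v ->]] := (mev_surj g, mev_surj h).
by rewrite -mev_cat !iota_mev /emb map_cat aev_cat.
Qed.

Lemma iota1 : iotaA 1 = 1. Proof. exact: (iota_mev [::]). Qed.

Lemma iota_inj : injective iotaA.
Proof.
move=> g h; have [[u ->] [v ->]] := (mev_surj g, mev_surj h).
by rewrite !iota_mev => /aev_mev.
Qed.

Lemma iotaX g n : iotaA (g ^+ n) = iotaA g ^+ n.
Proof. by elim: n => [|n IH]; rewrite ?iota1 // !expgS iotaM IH. Qed.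

Lemma mev_eq1 g h : g * h = 1 -> g = 1.
Proof.
have [[u ->] [v ->]] := (mev_surj g, mev_surj h).
by rewrite -mev_cat => /mev_size; case: u.
Qed.

Definition delta : A := iotaA Dlt.
Definition delta2 : A := delta * delta.

Lemma delta2_def : delta2 = delta * delta. Proof. by []. Qed.

Lemma delta2E : delta2 = iotaA Dlt2. Proof. by rewrite iotaM. Qed.

Lemma aev_neg s : aev [:: (s, false)] = (aev [:: (s, true)])^-1.
Proof. by rewrite aev_inv. Qed.

Lemma delta2C x : commute x delta2.
Proof.
have [w ->] := aev_surj x; elim: w => [|[s b] w IH].
  by rewrite /commute mul1g mulg1.
have sC : commute (aev [:: (s, true)]) delta2.
  rewrite delta2E -(iota_mev [:: s]) /commute -!iotaM; congr iotaA; exact: Dlt2C.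
rewrite aev_cons; apply/commute_sym/commuteM; last exact: commute_sym.
by case: b; rewrite ?aev_neg; [|apply: commuteV]; apply: commute_sym.
Qed.

Lemma aev_ppart w : aev w * delta2 ^+ nneg w = iotaA (ppart w).
Proof.
elim: w => [|[s b] w IH]; first by rewrite mulg1 iota1.
rewrite aev_cons [nneg _]/= [ppart _]/= iotaM -IH expgnDr.
rewrite -(mulgA (aev [:: (s, b)])) (mulgA (aev w) (delta2 ^+ _)).
rewrite (commuteX _ (delta2C (aev w))).
rewrite !mulgA; congr (_ * _ * _).
case: b; first by rewrite mulg1 iota_mev.
rewrite expg1 aev_neg; apply: (mulgI (aev [:: (s, true)])).
rewrite mulVKg delta2E -(iota_mev [:: s]) -iotaM; congr iotaA.
by rewrite -(fpos_neg s true).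
Qed.

Definition le (x y : A) : Prop := exists g, y = x * iotaA g.

Lemma le_refl x : le x x. Proof. by exists 1; rewrite iota1 mulg1. Qed.

Lemma le_trans y x z : le x y -> le y z -> le x z.
Proof. by move=> [g ->] [h ->]; exists (g * h); rewrite iotaM mulgA. Qed.

Lemma le_anti x y : le x y -> le y x -> x = y.
Proof.
move=> [g ->] [h]; rewrite -mulgA -{1}(mulg1 x) => /mulgI.
by rewrite -iotaM -iota1 => /iota_inj/esym/mev_eq1 ->; rewrite iota1 mulg1.
Qed.

Lemma le_mull z x y : le (z * x) (z * y) <-> le x y.
Proof.
split=> [[g]|[g ->]]; last by exists g; rewrite mulgA.
by rewrite -mulgA => /mulgI ->; exists g.
Qed.

Lemma le_mul_iota x g : le x (x * iotaA g). Proof. by exists g. Qed.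

(** Conjugation by [Delta], in either direction, maps positive elements to positive ones. *)
Lemma le_mulr_delta x y : le (x * delta) (y * delta) <-> le x y.
Proof.
split=> [] [g].
  have [h E] := Dlt_mul g; rewrite -mulgA -iotaM E iotaM mulgA => /mulIg ->.
  exact: le_mul_iota.
move=> ->; have [h E] := mul_Dlt g; rewrite -mulgA -iotaM E iotaM mulgA.
exact: le_mul_iota.
Qed.

Lemma ge_delta2N x : exists N, forall n, N <= n -> le (delta2 ^- n) x.
Proof.
have [w ->] := aev_surj x; exists (nneg w) => n /subnK <-.
exists (ppart w * Dlt2 ^+ (n - nneg w)).
apply: (mulgI (delta2 ^+ (n - nneg w + nneg w))); rewrite mulVKg.
rewrite iotaM -aev_ppart iotaX -delta2E -mulgA -expgnDr addnC.
by apply: commute_sym; apply: commuteX; apply: delta2C.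
Qed.

Lemma common_lower x y z : exists n, [/\ le (delta2 ^- n) x, le (delta2 ^- n) y & le (delta2 ^- n) z].
Proof.
have [[i xi] [j yj]] := (ge_delta2N x, ge_delta2N y); have [k zk] := ge_delta2N z.
by exists (i + j + k); split; [apply: xi | apply: yj | apply: zk]; lia.
Qed.

Lemma le_generators z s t x : s != t -> le (z * iotaA (mev [:: s])) x ->
  le (z * iotaA (mev [:: t])) x -> le (z * iotaA (mev (alt s t (m s t)))) x.
Proof.
move=> st [g ->] [h]; rewrite -!mulgA -!iotaM => /mulgI/iota_inj gh.
have [k ->] := mev_cons_alt cm w0_max st gh.
by rewrite iotaM mulgA; apply: le_mul_iota.
Qed.

Definition deg_step (x : S * bool) (n : int) : int :=
  (n + (if x.2 then 1 else -1))%R.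

(** The exponent sum, well defined because the two sides of each relation have the same one. *)
Definition deg (x : A) : int := foldr deg_step 0%R (repr x).

Lemma deg_aev w : deg (aev w) = foldr deg_step 0%R w.
Proof.
rewrite /deg; have : aev (repr (aev w)) = aev w by rewrite /aev /cls reprK.
move/aevP => E; apply: (cong_foldr _ E) => {E} x y [[s [b [-> ->]]]|[s [t [_ [-> ->]]]]] z.
  by case: b; rewrite /deg_step /=; lia.
rewrite !altw_emb.
have F (k : nat) s' t' n : foldr deg_step n (emb (alt s' t' k)) = (n + k%:Z)%R.
  by elim: k s' t' => [|k IH] s' t' /=; [|rewrite IH /deg_step /=]; lia.
by rewrite !F.
Qed.

Lemma degM x y : deg (x * y) = (deg x + deg y)%R.
Proof.
have [[u ->] [v ->]] := (aev_surj x, aev_surj y); rewrite -aev_cat !deg_aev.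
by elim: u => [|a u IH] /=; [|rewrite IH /deg_step]; lia.
Qed.

Lemma deg1 : deg 1 = 0%R. Proof. exact: (deg_aev [::]). Qed.

Lemma degV x : deg x^-1 = (- deg x)%R.
Proof. by have := degM x x^-1; rewrite mulgV deg1; lia. Qed.

Lemma degX x n : deg (x ^+ n) = (n%:Z * deg x)%R.
Proof.
elim: n => [|n IH]; first by rewrite deg1 GRing.mul0r.
by rewrite expgS degM IH intS GRing.mulrDl GRing.mul1r.
Qed.

Lemma deg_mev u : deg (iotaA (mev u)) = size u.
Proof.
by rewrite iota_mev deg_aev; elim: u => //= s u ->; rewrite /deg_step /=; lia.
Qed.

Lemma deg_iota_ge0 g : (0 <= deg (iotaA g))%R.
Proof. by have [u ->] := mev_surj g; rewrite deg_mev. Qed.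

Lemma le_deg x y : le x y -> (deg x <= deg y)%R.
Proof. by move=> [g ->]; rewrite degM; have := deg_iota_ge0 g; lia. Qed.

Section Glb.
Variables a b : A.

Let r x y := exists s, [/\ y = x * iotaA (mev [:: s]), le y a & le y b].

Let reach_le x y : le x a -> le x b -> reach r x y -> [/\ le x y, le y a & le y b].
Proof.
move=> xa xb xy; elim: xy xa xb => {x y} [x|x _ z [s [-> xsa xsb]] _ IH] xa xb.
  by split=> //; apply: le_refl.
have [xsz za zb] := IH xsa xsb; split=> //; apply: le_trans xsz.
exact: le_mul_iota.
Qed.

Let reach_mev x u : le (x * iotaA (mev u)) a -> le (x * iotaA (mev u)) b ->
  reach r x (x * iotaA (mev u)).
Proof.
elim: u x => [|s u IH] x; first by rewrite iota1 mulg1 => *; apply: reach_refl.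
rewrite mev_cons iotaM mulgA => xa xb.
apply: (@reach_step _ _ _ (x * iotaA (mev [:: s]))); last exact: IH.
by exists s; split=> //; [apply: le_trans xa | apply: le_trans xb]; apply: le_mul_iota.
Qed.

Let reach_of_le x y : le x y -> le y a -> le y b -> reach r x y.
Proof. by move=> [g ->]; have [u ->] := mev_surj g; apply: reach_mev. Qed.

Let confl x y z : r x y -> r x z -> exists2 w, reach r y w & reach r z w.
Proof.
move=> [s [-> xsa xsb]] [t [-> xta xtb]].
have [<-|st] := eqVneq s t; first by exists (x * iotaA (mev [:: s])); apply: reach_refl.
have wa := le_generators st xsa xta; have wb := le_generators st xsb xtb.
have [_ [msym mge2]] := cm; have mst := mge2 _ _ st.
exists (x * iotaA (mev (alt s t (m s t)))); apply: reach_of_le => //.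
  case: (m s t) mst => // k _.
  by rewrite [X in le _ (_ * iotaA X)]mev_cons iotaM mulgA; apply: le_mul_iota.
rewrite mev_braid //; case: (m s t) mst => // k _.
by rewrite [X in le _ (_ * iotaA X)]mev_cons iotaM mulgA; apply: le_mul_iota.
Qed.

Lemma glb_ex : exists c, [/\ le c a, le c b & forall x, le x a -> le x b -> le x c].
Proof.
have top z : le z a -> le z b -> exists n, [/\ le z n, le n a, le n b &
    forall x, le z x -> le x a -> le x b -> le x n].
  move=> za zb.
  have [|n zn n_top] := newman (mu := fun x => `|deg a - deg x|%N) _ confl z.
    move=> x y [s [-> xsa _]]; have := le_deg xsa; rewrite degM deg_mev /=; lia.
  have [zn' na nb] := reach_le za zb zn; exists n; split=> // x zx xa xb.
  have := n_top _ (reach_of_le zx xa xb) => xn.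
  by case: (reach_le xa xb xn).
have [i [ia ib _]] := common_lower a b a.
have [n [zn na nb n_top]] := top _ ia ib; exists n; split=> // x xa xb.
(* The lower bound [x] need not lie above the first starting point. A restart below both [x] and [n]
   ends at some [n'] above both, and the choice of [n] forces [n'] back under [n]. *)
have [j [jn jx _]] := common_lower n x x.
have [n' [_ n'a n'b n'_top]] := top _ (le_trans jn na) (le_trans jn nb).
apply: le_trans (n'_top _ jx xa xb) _; apply: n_top => //.
exact/(le_trans zn)/n'_top.
Qed.

End Glb.

Definition is_glb (F : nat -> A) n y :=
  (forall i, i < n -> le y (F i)) /\
  (forall z, (forall i, i < n -> le z (F i)) -> le z y).

Lemma is_glb_ex F n : 0 < n -> exists y, is_glb F n y.
Proof.
case: n => // n _; elim: n => [|n [y [yF y_max]]].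
  exists (F 0); split=> [[]// _|z]; first exact: le_refl.
  exact.
have [c [cy cF c_max]] := glb_ex y (F n.+1).
exists c; split=> [i|z zF].
  by rewrite ltnS leq_eqVlt => /orP[/eqP-> //|/yF]; apply: le_trans.
by apply: c_max (zF _ _) => //; apply: y_max => i /ltnW; apply: zF.
Qed.

Lemma is_glb_uniq F n y y' : is_glb F n y -> is_glb F n y' -> y = y'.
Proof. by move=> [yF y_max] [y'F y'_max]; apply: le_anti; [apply: y'_max | apply: y_max]. Qed.

End GarsideGroup.

(** * Roots of the square of Delta *)

Section Periodic.
Variables (S : finType) (m : S -> S -> nat).
Hypothesis cm : coxeter_matrix m.
Local Notation W := (cox_grp m).
Local Notation M := (braid_mon m).
Local Notation A := (artin_grp m).
Variable w0 : W.
Hypothesis w0_max : forall a : W, wlen a <= wlen w0.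
Local Notation delta := (delta w0).
Local Notation delta2 := (delta2 w0).
Implicit Types (x y z : A) (f h : A -> A).

Definition oaut f :=
  (forall z, exists x, f x = z) /\ (forall x y, le (f x) (f y) <-> le x y).

Lemma oaut_mul a : oaut (mul a).
Proof.
split=> [z|x y]; first by exists (a^-1 * z); rewrite mulVKg.
exact: le_mull.
Qed.

Lemma oaut_mul_delta a : oaut (fun x => a * x * delta^-1).
Proof.
split=> [z|x y].
  by exists (a^-1 * z * delta); rewrite !mulgA mulgV mul1g mulgK.
by rewrite -(le_mulr_delta cm w0_max) !mulgVK le_mull.
Qed.

Lemma oaut_glb f F n y : oaut f -> is_glb F n y -> is_glb (f \o F) n (f y).
Proof.
move=> [fsurj fle] [yF y_max]; split=> [i /yF|z]; first by rewrite /= fle.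
have [x <-] := fsurj z => xF; apply/fle/y_max => i /xF.
by rewrite /= fle.
Qed.

Lemma oaut_le_iter f y i : oaut f -> le y (f y) -> le y (iter i f y).
Proof.
move=> [_ fle] yfy; elim: i => [|i IH]; first exact: le_refl.
by apply: le_trans yfy _; rewrite iterS fle.
Qed.

(** Applying [f] to the meet of the orbit replaces [x] by [f^n x], which lies above [x], so the meet
    can only go up. Being canonical, it is fixed by automorphisms that commute with [f] and fix
    [x]. *)
Lemma orbit_glb f n x : oaut f -> 0 < n -> le x (iter n f x) ->
  exists2 y, le y (f y) & forall h, oaut h -> (forall z, h (f z) = f (h z)) ->
    h x = x -> h y = y.
Proof.
move=> fa n0 xfx.
(* y is the meet of x, f x, ..., f^(n-1) x *)
have [y yglb] := is_glb_ex cm w0_max (fun i => iter i f x) n0.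
exists y => [|h ha hf hx].
  have [yF _] := yglb; have [_] := oaut_glb fa yglb; apply=> i i_n /=.
  rewrite -iterS; have [in'|] := ltnP i.+1 n; first exact: yF.
  move=> ni; have -> : i.+1 = n by lia.
  exact: le_trans (yF 0 n0) xfx.
have hyglb := oaut_glb ha yglb.
apply: (is_glb_uniq cm w0_max) hyglb _.
rewrite (_ : h \o _ = fun i => iter i f x) //; apply: funext => i /=.
by elim: i => //= i IH; rewrite hf IH.
Qed.

(** For [y] with [y <= x y], the chain [y <= x y <= ... <= x^n y = y] collapses. *)
Lemma artin_torsion_free x n : 0 < n -> x ^+ n = 1 -> x = 1.
Proof.
case: n => // n _ xn.
have [|y yxy _] := orbit_glb (n := n.+1) (oaut_mul x) isT (x := 1).
  by rewrite iter_mulg xn mulg1; apply: le_refl.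
suff : x * y = y by rewrite -[in RHS](mul1g y) => /mulIg.
apply: (le_anti cm w0_max) => //.
have : le (x * y) (x * (x ^+ n * y)).
  apply/le_mull; rewrite -iter_mulg; apply: oaut_le_iter => //.
  exact: oaut_mul.
by rewrite mulgA -expgS xn mul1g.
Qed.

Definition dbar x : A := delta * x * delta^-1.

Lemma dbar_def x : dbar x = delta * x * delta^-1. Proof. by []. Qed.

Lemma dbarM x y : dbar (x * y) = dbar x * dbar y.
Proof. by rewrite /dbar !mulgA mulgVK. Qed.

Lemma dbar_delta x : dbar x * delta = delta * x.
Proof. by rewrite /dbar mulgVK. Qed.

Lemma dbarK : involutive dbar.
Proof.
move=> x; have := delta2C cm w0_max x; rewrite /commute /delta2 => E.
by rewrite /dbar !mulgA -E !mulgA !mulgK.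
Qed.

Definition altg (a b : A) (n : nat) : A := foldr mul 1 (alt a b n).

Lemma dbar_altg a b n : dbar (altg a b n) = altg (dbar a) (dbar b) n.
Proof.
have d1 : dbar 1 = 1 by rewrite /dbar mulg1 mulgV.
by rewrite /altg; elim: n a b => //= n IH a b; rewrite dbarM IH.
Qed.

Lemma altgS x n : altg x (dbar x) n.+1 = x * dbar (altg x (dbar x) n).
Proof. by rewrite dbar_altg dbarK. Qed.

Lemma conj_expg (g y : A) n : (y^-1 * g * y) ^+ n = y^-1 * g ^+ n * y.
Proof.
elim: n => [|n IH]; first by rewrite mulg1 mulVg.
by rewrite !expgS IH !mulgA mulgK.
Qed.

Lemma root_even g k : 0 < k -> g ^+ k.*2 = delta2 ->
  exists y, [/\ (y^-1 * g * y) ^+ k = delta & le 1 (y^-1 * g * y)].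
Proof.
move=> k0 gk; pose tau x := g ^+ k * x * delta^-1.
have tauK x : tau (tau x) = x.
  by rewrite /tau !mulgA -expgnDr addnn gk -(delta2C cm w0_max x) !mulgA !mulgK.
have tau_aut := oaut_mul_delta (g ^+ k).
(* Starting from 1, the meet [x] satisfies [x <= tau x]; as [tau] is an involution, equality
   follows. *)
have [|x xtx _] := orbit_glb (n := 2) tau_aut isT (x := 1).
  by rewrite /= -!/(tau _) tauK; apply: le_refl.
have tx : tau x = x.
  apply: (le_anti cm w0_max) => //; rewrite -[X in le _ X]tauK.
  by have [_ ->] := tau_aut.
have gkx : g ^+ k * x = x * delta by rewrite -{2}tx /tau mulgVK.
(* Now [g^k x = x Delta] lies above [x], so the meet [y] of the orbit of [x] under [g] satisfies
   [y <= g y]. It stays fixed by [tau], which commutes with [g]. *)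
have [|y yty y_fix] := orbit_glb (n := k) (oaut_mul g) k0 (x := x).
  by rewrite iter_mulg gkx; exists (Dlt w0).
have ty : tau y = y.
  apply: (y_fix tau) => // z; rewrite /tau !mulgA; congr (_ * _ * _).
  by rewrite -expgS expgSr.
have gky : g ^+ k * y = y * delta by rewrite -{2}ty /tau mulgVK.
exists y; split; first by rewrite conj_expg -mulgA gky mulKg.
by rewrite -(le_mull y) mulg1 !mulgA mulgV mul1g.
Qed.

Lemma root_odd g j : g ^+ j.*2.+1 = delta2 ->
  exists y, let b := y^-1 * g ^+ j.+1 * y * delta^-1 in
    le 1 b /\ altg b (dbar b) j.*2.+1 = delta.
Proof.
move=> gj; pose sg x := g ^+ j.+1 * x * delta^-1.
have sg_iter i x : iter i sg x = (g ^+ j.+1) ^+ i * x * delta ^- i.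
  elim: i => [|i IH]; first by rewrite mul1g invg1 mulg1.
  by rewrite iterS IH /sg [delta ^+ i.+1]expgS invgM (expgS (g ^+ j.+1)) !mulgA.
(* With [n = 2j + 1], [g^((j+1) n) = Delta^(2j+2) = Delta^(n+1)]; removing [n] factors leaves one
   [Delta] on the right. *)
have sg_n x : iter j.*2.+1 sg x = x * delta.
  rewrite sg_iter -expgnA mulnC expgnA gj -(commuteX _ (delta2C cm w0_max x)).
  rewrite delta2_def -expg2 -expgnA (_ : (2 * j.+1 = j.*2.+1.+1)%N); last by lia.
  by rewrite expgS mulgA mulgK.
have sg_aut := oaut_mul_delta (g ^+ j.+1).
have [|y ysy _] := orbit_glb (n := j.*2.+1) sg_aut isT (x := 1).
  by rewrite -/sg sg_n; exists (Dlt w0); rewrite mul1g.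
exists y => b; have yb : y * b = sg y by rewrite /b /sg !mulgA mulgV mul1g.
split; first by rewrite -(le_mull y) mulg1 yb.
(* Since [sg (y p) = y b (dbar p)], each step prepends [b] and bars the rest, which builds the
   alternating products. *)
have E i : iter i sg y = y * altg b (dbar b) i.
  elim: i => [|i IH]; first by rewrite mulg1.
  rewrite iterS IH altgS mulgA yb /sg /dbar !mulgA; congr (_ * _ * _).
  by rewrite mulgVK.
by apply: (mulgI y); rewrite -E sg_n.
Qed.

End Periodic.

(** * Finite subgroups *)

Section EqualUpToPowers.
Variables (G : groupType) (c : G).

(** Equality of left cosets of the powers of [c], with an exponent on each side to stay within
    natural numbers. For [delta2] this is equality in the quotient group, for [delta] equality of
    vertices. *)
Definition eqpow (x y : G) := exists i j, x * c ^+ i = y * c ^+ j.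

Lemma eqpow_refl x : eqpow x x. Proof. by exists 0, 0. Qed.
Lemma eqpow_sym x y : eqpow x y -> eqpow y x.
Proof. by move=> [i [j E]]; exists j, i. Qed.
Lemma eqpow_trans y x z : eqpow x y -> eqpow y z -> eqpow x z.
Proof.
move=> [i [j E]] [k [l F]]; exists (i + k), (l + j).
by rewrite !expgnDr !mulgA E -F -!mulgA -!expgnDr addnC.
Qed.
Lemma eqpow_mull z x y : eqpow x y -> eqpow (z * x) (z * y).
Proof. by move=> [i [j E]]; exists i, j; rewrite -!mulgA E. Qed.
Lemma eqpow_mulX x i : eqpow (x * c ^+ i) x.
Proof. by exists 0, i; rewrite mulg1. Qed.
Lemma eqpow_mul x : eqpow (x * c) x.
Proof. exact: (eqpow_mulX x 1). Qed.

End EqualUpToPowers.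

Section FiniteSubgroups.
Variables (S : finType) (m : S -> S -> nat).
Hypothesis cm : coxeter_matrix m.
Local Notation W := (cox_grp m).
Local Notation M := (braid_mon m).
Local Notation A := (artin_grp m).
Variable w0 : W.
Hypothesis w0_max : forall a : W, wlen a <= wlen w0.
Local Notation delta := (delta w0).
Local Notation delta2 := (delta2 w0).
Local Notation dbar := (dbar w0).
Local Notation aev := (aev m).
Local Notation deg := (@deg S m).
Implicit Types (x y z : A).

Lemma deg_delta_ge0 : (0 <= deg delta)%R.
Proof. exact: deg_iota_ge0. Qed.

(** Each generator divides [Delta], so degree 0 forces [S] to be empty. *)
Lemma artin_trivial : deg delta = 0%R -> forall x, x = 1.
Proof.
move=> d0; have noS : S -> False.
  move=> s; have := degM (iotaA (mev m [:: s])) (iotaA (mlift ((gen m s)^-1 * w0))).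
  rewrite -iotaM -{1}(mlift_gen cm) (mlift_compl cm w0_max) [iotaA _]/(delta) d0.
  rewrite deg_mev /=.
  by have := deg_iota_ge0 (mlift ((gen m s)^-1 * w0)); lia.
by move=> x; have [[|[s b] w] ->] := aev_surj x; rewrite // (False_ind _ (noS s)).
Qed.

(** [K] stands for the preimage in the Artin group of a finite subgroup of the quotient, [L] for a
    list of representatives. *)
Variables (K : A -> Prop) (L : seq A).
Hypotheses (K1 : K 1) (KM : forall x y, K x -> K y -> K (x * y))
  (KV : forall x, K x -> K x^-1) (Kd : K delta2).
Hypothesis K_fin : forall x, K x -> exists2 y, y \in L & eqpow delta2 x y.

Lemma KX x n : K x -> K (x ^+ n).
Proof. by move=> Kx; elim: n => // n IH; rewrite expgS; apply: KM. Qed.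

Lemma deg_delta2 : deg delta2 = (deg delta + deg delta)%R.
Proof. exact: degM. Qed.

(** By pigeonhole two powers of [x] agree modulo [delta2]; comparing degrees makes the agreement
    exact, and torsion-freeness concludes. *)
Lemma fin_deg0 x : (0 < deg delta)%R -> K x -> deg x = 0%R -> x = 1.
Proof.
move=> d0 Kx x0.
have ex i : exists y, y \in L /\ eqpow delta2 (x ^+ i) y.
  by have [y yL E] := K_fin (KX i Kx); exists y.
pose f i := sval (cid (ex i)).
have fL i : f i \in L by rewrite /f; case: cid => y [].
have fE i : eqpow delta2 (x ^+ i) (f i) by rewrite /f; case: cid => y [].
have : ~~ uniq (mkseq f (size L).+1).
  apply/negP => uf; have : size (mkseq f (size L).+1) <= size L.
    by apply: uniq_leq_size uf _ => _ /mapP[i _ ->].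
  by rewrite size_mkseq ltnn.
move=> /(uniqPn 1) [i [j [ij]]]; rewrite size_mkseq => jL.
rewrite !nth_mkseq // 1?(ltn_trans ij) // => fij.
have [a [b E]] : eqpow delta2 (x ^+ i) (x ^+ j).
  apply: eqpow_trans (fE i) _; rewrite fij; exact: eqpow_sym.
have ab : a = b.
  have := congr1 deg E; rewrite !degM !degX x0 deg_delta2 !GRing.mulr0 !GRing.add0r.
  by nia.
move: E; rewrite ab => /mulIg E.
apply: (artin_torsion_free cm w0_max (n := j - i)); first by rewrite subn_gt0.
by rewrite expgnFr 1?ltnW // E mulgV.
Qed.

(** The degree is injective on [K], so a member of least positive degree generates it and [delta2]
    is one of its powers. If [Delta] has degree 0, the group is trivial and [n = 1]. *)
Lemma fin_cyclic : exists g n, 0 < n /\ [/\ K g, g ^+ n = delta2,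
  (forall x, K x -> exists i j, x * delta2 ^+ j = g ^+ i),
  ((0 < deg delta)%R \/ n = 1%N) &
  forall i j, i < n -> j < n -> eqpow delta2 (g ^+ i) (g ^+ j) -> i = j].
Proof.
have [d0|d0] : (0 < deg delta)%R \/ deg delta = 0%R by have := deg_delta_ge0; lia.
  have exP : exists n, `[< exists x, K x /\ deg x = n.+1 >].
    exists (`|deg delta2|.-1)%N; apply/asboolP; exists delta2; split=> //.
    by have := deg_delta2; lia.
  have [e /asboolP [g [Kg ge]] e_min] := ex_minnP exP.
  have pow (n : nat) x : K x -> deg x = n -> exists i, x = g ^+ i.
    have [k] := ubnP n; elim: k n x => // k IH n x nk Kx xn.
    case: n nk xn => [|n] nk xn; first by exists 0; apply: fin_deg0.
    have en : e <= n by apply: e_min; apply/asboolP; exists x.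
    have [||i E] := IH (n - e) (x * g^-1) _ (KM Kx (KV Kg)); first by lia.
      by rewrite degM degV; lia.
    by exists i.+1; rewrite expgSr -E mulgVK.
  have [|n gn] := pow `|deg delta2|%N _ Kd; first by have := deg_delta2; lia.
  have n0 : 0 < n.
    case: n gn => // gn; have := deg_delta2; rewrite gn deg1; lia.
  have gI i j : g ^+ i = g ^+ j -> i = j.
    by move=> /(congr1 deg); rewrite !degX ge; nia.
  exists g, n; split=> //; split=> // [x Kx||i j i_n j_n [a [b]]]; last 1 first.
  - rewrite gn -!expgnA -!expgnDr => /gI E.
    by have := congr1 (modn^~ n) E; rewrite /= !(addnC _ (n * _)%N) !(mulnC n) !modnMDl !modn_small.
  (* Enough factors [delta2] make the degree nonnegative, so that [pow] applies. *)
  - pose k : nat := `|deg x|%N.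
    have [|i E] := pow `|deg (x * delta2 ^+ k)%g|%N _ (KM Kx (KX k Kd)).
      by rewrite degM degX; have := deg_delta2; rewrite /k; nia.
    by exists i, k.
  by left.
have triv := artin_trivial d0; exists 1, 1%N; split=> //; split=> //.
- by move=> x _; exists 0, 0; rewrite [LHS]triv.
- by right.
by move=> [|i] [|j].
Qed.

End FiniteSubgroups.

(** * Coxeter length of words with inverses *)

Section CoxeterLength.
Variables (S : finType) (m : S -> S -> nat).
Local Notation wev := (wev m).

Lemma weq_emb u : weq m u (emb (map fst u)).
Proof.
elim: u => [|[s b] u IH]; first exact: cong_refl.
rewrite -cat1s [emb _]/= -[(s, true) :: _]cat1s; apply: cong_cat IH.
case: b; first exact: cong_refl.
apply: (@cong_trans _ _ _ [:: (s, false); (s, true); (s, true)]).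
  apply/cong_sym/(@cong_step _ _ [:: (s, false)] [::] [:: (s, true); (s, true)] [::]).
  by right; right; exists s.
apply: (@cong_step _ _ [::] [:: (s, true)] [:: (s, false); (s, true)] [::]).
by left; exists s, false.
Qed.

Lemma weqP u v : weq m u v <-> wev (map fst u) = wev (map fst v).
Proof.
have uE := weq_emb u; have vE := weq_emb v; rewrite wevP; split=> E.
  exact: cong_trans (cong_sym uE) (cong_trans E vE).
exact: cong_trans uE (cong_trans E (cong_sym vE)).
Qed.

Lemma cox_lengthP u n : cox_length m u n <-> wlen (wev (map fst u)) = n.
Proof.
have [r [rr Er]] := reduced_ex (wev (map fst u)).
split=> [[[v [<- /weqP vu]] u_min]|<-].
  apply/eqP; rewrite eqn_leq -{1}vu -{1}(size_map fst v) wlen_le -Er -(eqP rr).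
  rewrite -(size_map (fun s => (s, true)) r); apply: u_min; apply/weqP.
  by rewrite map_fst_emb.
split=> [|v /weqP <-]; last by rewrite -(size_map fst v) wlen_le.
exists (emb r); rewrite size_map (eqP rr) Er; split=> //.
by apply/weqP; rewrite map_fst_emb.
Qed.

End CoxeterLength.

(** * Atoms, vertices and adjacency in terms of the lattice order *)

Section Translation.
Variables (S : finType) (m : S -> S -> nat).
Hypothesis cm : coxeter_matrix m.
Local Notation W := (cox_grp m).
Local Notation A := (artin_grp m).
Local Notation wev := (wev m).
Local Notation mev := (mev m).
Local Notation aev := (aev m).
Variables (w0 : W) (d : word S).
Hypothesis w0_max : forall a : W, wlen a <= wlen w0.
Local Notation delta := (delta w0).
Local Notation delta2 := (delta2 w0).
Local Notation dbar := (dbar w0).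
Hypothesis dE : aev d = delta.
Implicit Types (x y z v w : word S).

(** A positive word for [x] followed by one for the rest of [Delta] has the length of [w0], hence is
    reduced, and so is its prefix. *)
Lemma simple_atom x : le 1 (aev x) -> le (aev x) delta -> atom m x.
Proof.
move=> [g]; rewrite mul1g => xg [h]; rewrite xg -iotaM => /(iota_inj cm w0_max).
have [r [rr r0]] := reduced_ex w0.
rewrite /Dlt -r0 (mlift_reduced cm rr).
have [[u gu] [v ->]] := (mev_surj g, mev_surj h); rewrite gu -mev_cat => E.
have [ru _] : reduced m u /\ reduced m v.
  by apply: reduced_cat; rewrite /reduced -(mev_wev E) -(mev_size E).
exists (emb u); split; first exact: pos_emb.
split; first by apply/aevP; rewrite xg gu iota_mev.
by apply/cox_lengthP; rewrite map_fst_emb size_map; apply/esym/eqP.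
Qed.

Lemma aev_flatten_nseq n w : aev (flatten (nseq n w)) = aev w ^+ n.
Proof. by elim: n => //= n IH; rewrite aev_cat IH expgS. Qed.

Lemma aev_wpow w n : aev (wpow w (Posz n)) = aev w ^+ n.
Proof. exact: aev_flatten_nseq. Qed.

Lemma aev_wpowN w n : aev (wpow w (Negz n)) = aev w ^- n.+1.
Proof. by rewrite -expVgn aev_inv; apply: (aev_flatten_nseq n.+1). Qed.

Lemma veqP x y : veq m d x y <-> eqpow delta (aev x) (aev y).
Proof.
split=> [[[n|n] /aevP E]|[i [j E]]].
- by exists n, 0; rewrite mulg1 E aev_cat aev_wpow dE.
- by exists 0, n.+1; rewrite mulg1 E aev_cat aev_wpowN dE mulgVK.
have [ji|ij] := leqP j i.
  exists (Posz (i - j)); apply/aevP; rewrite aev_cat aev_wpow dE.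
  by apply: (mulIg (delta ^+ j)); rewrite -mulgA -expgnDr subnK.
exists (Negz (j - i.+1)); apply/aevP; rewrite aev_cat aev_wpowN dE.
rewrite subnSK //; apply: (mulIg (delta ^+ (j - i))); rewrite mulgVK.
by apply: (mulIg (delta ^+ i)); rewrite E -mulgA -expgnDr subnK // ltnW.
Qed.

Lemma geq_aeq x y : aeq m x y -> Defs.geq m d x y.
Proof.
apply: cong_sub => {}x {}y xy; apply: cong_rel; by case: xy => xy; [left | right; left].
Qed.

Lemma geqP x y : Defs.geq m d x y <-> eqpow delta2 (aev x) (aev y).
Proof.
split.
  elim=> {x y} [x|x y _|x y z _ xy _|u v x y R].
  - exact: eqpow_refl.
  - exact: eqpow_sym.
  - exact: eqpow_trans.
  rewrite !aev_cat; apply: eqpow_mull.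
  suff [i [j E]] : eqpow delta2 (aev x) (aev y).
    exists i, j; rewrite -!mulgA !(commuteX _ (delta2C cm w0_max (aev v))).
    by rewrite !mulgA E.
  have [xy|[xy|[-> ->]]] := R; last by exists 0, 1%N; rewrite aev_cat dE mulg1 mul1g.
    by rewrite (_ : aev x = aev y); [apply: eqpow_refl | apply/aevP/cong_rel; left].
  by rewrite (_ : aev x = aev y); [apply: eqpow_refl | apply/aevP/cong_rel; right].
move=> [i [j E]].
have pad z k : Defs.geq m d z (z ++ flatten (nseq k (d ++ d))).
  elim: k => [|k IH]; first by rewrite cats0; apply: cong_refl.
  apply: cong_trans IH _; rewrite [nseq _ _]/= [flatten (_ :: _)]/=.
  apply/cong_sym; apply: (@cong_step _ _ z (flatten _) (d ++ d) [::]).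
  by right; right.
apply: cong_trans (pad x i) _; apply: cong_trans _ (cong_sym (pad y j)).
apply/geq_aeq/aevP; rewrite !aev_cat !aev_flatten_nseq aev_cat dE; exact: E.
Qed.

Lemma eqpow_delta_mulr (a b c : A) :
  eqpow delta2 a b -> eqpow delta (a * c) (b * c).
Proof.
move=> [i [j E]]; exists (2 * i)%N, (2 * j)%N; rewrite !expgnA !expg2 -!mulgA.
by rewrite !(commuteX _ (delta2C cm w0_max c)) !mulgA E.
Qed.

(** For [v <= w] the quotient [v^-1 w] is simple; for [w <= v], [v^-1 w Delta] is, and represents
    the same vertex. It is neither 1 nor [Delta] because the vertices differ, so it is its own
    normal form with one atom. *)
Lemma dat1_simple v w : le 1 (aev v) -> le (aev v) delta ->
    le 1 (aev w) -> le (aev w) delta ->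
    le (aev v) (aev w) \/ le (aev w) (aev v) ->
  ~ veq m d v w -> dat1 m d v w.
Proof.
move=> v1 vd w1 wd cmp vw.
have [a [ea a1 ad]] : exists a, [/\ eqpow delta ((aev v)^-1 * aev w) a, le 1 a & le a delta].
  have ddelta (x : A) : le 1 x -> le delta (x * delta).
    by move=> x1; rewrite -{1}(mul1g delta) (le_mulr_delta cm w0_max).
  case: cmp => [vw'|wv].
    exists ((aev v)^-1 * aev w); split; first exact: eqpow_refl.
      by rewrite -(le_mull (aev v)) mulg1 mulVKg.
    by rewrite -(le_mull (aev v)) mulVKg; apply: le_trans wd (ddelta _ v1).
  exists ((aev v)^-1 * aev w * delta); split.
  - exact/eqpow_sym/eqpow_mul.
  - rewrite -(le_mull (aev v)) mulg1 -mulgA mulVKg.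
    exact: le_trans vd (ddelta _ w1).
  by rewrite -(le_mull (aev v)) -mulgA mulVKg (le_mulr_delta cm w0_max).
have [p pa] := aev_surj a; rewrite pa in ea a1 ad.
have pV : eqpow delta (aev (winv v ++ w)) (aev p) by rewrite aev_cat -aev_inv.
have p_atom : atom m p by apply: simple_atom.
have p_neq1 : ~ eqpow delta (aev p) 1.
  move=> p1; apply: vw; apply/veqP/eqpow_sym.
  have := eqpow_mull (aev v) (eqpow_trans ea p1).
  by rewrite mulVKg mulg1.
exists v, p, [:: p]; split; first exact/veqP/eqpow_refl.
split=> //; split; first exact/veqP.
split; last first.
  move=> A'; rewrite inE => /eqP -> /aevP E; apply: p_neq1.
  by rewrite E dE; have := eqpow_mul delta 1; rewrite mul1g.
split.
  move=> A'; rewrite inE => /eqP ->; split=> // /aevP E; apply: p_neq1.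
  by rewrite E; apply: eqpow_refl.
split; first by rewrite /= cats0; apply: cong_refl.
case=> // _; rewrite drop0 /= cats0; split=> //; split=> //.
by exists [::]; split; [exists [::]; split=> //; apply: cong_refl | rewrite cats0; apply: cong_refl].
Qed.

(** * Simplices spanned by a cyclically permuted chain of simple elements *)

Section Orbit.
Variables (H : word S -> Prop) (g : word S) (f : nat -> word S) (k : nat).
Hypotheses (k_gt0 : 0 < k) (Hg : forall n, H (wpow g (Posz n)))
  (gH : forall h, H h -> exists n, Defs.geq m d h (wpow g (Posz n)))
  (f0 : aev (f 0) = 1) (fd : forall i, i < k -> le (aev (f i)) delta)
  (f_mono : forall i j, i <= j < k -> le (aev (f i)) (aev (f j)))
  (gf : forall i, i < k -> veq m d (g ++ f i) (f (i.+1 %% k))).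

Lemma orbit_power n i : i < k ->
  eqpow delta (aev g ^+ n * aev (f i)) (aev (f ((i + n) %% k))).
Proof.
move=> ik; elim: n => [|n IH].
  by rewrite mul1g addn0 modn_small //; apply: eqpow_refl.
rewrite expgS -mulgA; apply: eqpow_trans (eqpow_mull _ IH) _.
have := gf (ltn_pmod (i + n) k_gt0) => /veqP; rewrite aev_cat.
by rewrite -addn1 modnDml addn1 addnS.
Qed.

Lemma orbit_simplex :
  let sigma := mkseq f k in
  simplex m d sigma /\
  (exists2 v, v \in sigma & veq m d v [::]) /\
  (forall h v, H h -> v \in sigma -> exists2 w, w \in sigma & veq m d (h ++ v) w) /\
  (forall v w, v \in sigma -> w \in sigma -> exists h, H h /\ veq m d (h ++ v) w) /\
  vertices_are m d sigma f k.
Proof.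
move=> sigma.
have inS i : i < k -> f i \in sigma.
  by move=> ik; apply/mapP; exists i; rewrite ?mem_iota.
have sP v : v \in sigma -> exists2 i, i < k & v = f i.
  by move=> /mapP [i]; rewrite mem_iota => ik ->; exists i.
have f1 i : i < k -> le 1 (aev (f i)).
  by move=> ik; rewrite -f0; apply: f_mono; rewrite ik.
split.
  move=> _ _ /sP[i ik ->] /sP[j jk ->]; apply: dat1_simple; rewrite ?f1 ?fd //; try exact: f1; try exact: fd.
  by have [ij|/ltnW ji] := leqP i j; [left | right]; apply: f_mono; rewrite ?ij ?ji.
split; first by exists (f 0); [apply: inS | apply/veqP; rewrite f0; apply: eqpow_refl].
split.
  move=> h _ /gH [n /geqP E] /sP[i ik ->].
  exists (f ((i + n) %% k)); first by apply/inS/ltn_pmod.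
  apply/veqP; rewrite aev_cat; apply: eqpow_trans (orbit_power n ik).
  by apply: eqpow_delta_mulr; rewrite -aev_wpow.
split.
  (* The exponent is [j - i] modulo [k], with [k] added to keep it nonnegative. *)
  move=> _ _ /sP[i ik ->] /sP[j jk ->]; exists (wpow g (Posz (j + (k - i)))).
  split=> //; apply/veqP; rewrite aev_cat aev_wpow.
  have := orbit_power (j + (k - i)) ik.
  by rewrite addnCA subnKC ?(ltnW ik) // modnDr modn_small.
split.
  by move=> _ /sP[i ik ->]; exists i => //; apply/veqP/eqpow_refl.
by move=> i ik; exists (f i); [apply: inS | apply/veqP/eqpow_refl].
Qed.

End Orbit.

End Translation.

(** * The two types of finite subgroups *)

Section FiniteSubgroupTypes.
Variables (S : finType) (m : S -> S -> nat).
Hypothesis cm : coxeter_matrix m.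
Local Notation W := (cox_grp m).
Local Notation A := (artin_grp m).
Local Notation aev := (aev m).
Variables (w0 : W) (d : word S).
Hypothesis w0_max : forall a : W, wlen a <= wlen w0.
Local Notation delta := (delta w0).
Local Notation delta2 := (delta2 w0).
Local Notation dbar := (dbar w0).
Local Notation deg := (@deg S m).
Hypothesis dE : aev d = delta.

(* H is the conjugated subgroup and g generates its preimage in the Artin group. *)
Variables (H : word S -> Prop) (g : A) (n : nat).
Hypotheses (n_gt0 : 0 < n) (Hg : forall u i, aev u = g ^+ i -> H u)
  (gH : forall h, H h -> exists i j, aev h * delta2 ^+ j = g ^+ i)
  (gn : g ^+ n = delta2).

Let concl (ty : seq (word S) -> Prop) := exists sigma,
  simplex m d sigma /\
  (exists2 v, v \in sigma & veq m d v [::]) /\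
  (forall h v, H h -> v \in sigma -> exists2 w, w \in sigma & veq m d (h ++ v) w) /\
  (forall v w, v \in sigma -> w \in sigma -> exists h, H h /\ veq m d (h ++ v) w) /\
  ty sigma.

Lemma le1X (b : A) i j : le 1 b -> i <= j -> le (b ^+ i) (b ^+ j).
Proof.
move=> b1 /subnKC <-; rewrite expgnDr -{1}(mulg1 (b ^+ i)) le_mull.
elim: (j - i) => [|k IH]; first exact: le_refl.
by apply: le_trans b1 _; rewrite expgS -{1}(mulg1 b) le_mull.
Qed.

Lemma finite_subgroup_type1 k : n = k.*2 -> g ^+ k = delta -> le 1 g ->
  concl (fun sigma => type1 m d H sigma n).
Proof.
move=> nk gk g1; have k0 : 0 < k by rewrite -double_gt0 -nk.
have [b gb] := aev_surj g; pose f i := wpow b (Posz i).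
have fE i : aev (f i) = g ^+ i by rewrite aev_wpow gb.
have fd i : i < k -> le (aev (f i)) delta.
  by move=> ik; rewrite fE -gk; apply: le1X g1 (ltnW ik).
have Hf i : H (wpow b (Posz i)) by apply: (Hg (i := i)); apply: fE.
have Hgen h : H h -> exists i, Defs.geq m d h (wpow b (Posz i)).
  move=> /gH [i [j E]]; exists i; apply/(geqP cm w0_max dE).
  by rewrite aev_wpow -gb -E; apply/eqpow_sym/eqpow_mulX.
have f_mono i j : i <= j < k -> le (aev (f i)) (aev (f j)).
  by move=> /andP[ij _]; rewrite !fE; apply: le1X.
have gf i : i < k -> veq m d (b ++ f i) (f (i.+1 %% k)).
  move=> ik; apply/(veqP dE); rewrite aev_cat !fE -gb -expgS.
  have [lt|le] := ltnP i.+1 k; first by rewrite modn_small //; apply: eqpow_refl.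
  have -> : i.+1 = k by lia.
  by rewrite modnn gk; have := eqpow_mul delta 1; rewrite mul1g.
have [si [st [inv [tr vert]]]] := orbit_simplex cm w0_max dE k0 Hf Hgen (fE 0) fd f_mono gf.
exists (mkseq f k); do 4 split=> //.
have at_f i : i < k -> atom m (f i).
  move=> ik; apply: (simple_atom cm w0_max); last exact: fd.
  by rewrite fE; apply: (le1X g1 (leq0n i)).
have b_simple : le g delta by rewrite -gk; apply: (le1X (i := 1) g1 k0).
exists k, b; split; first by rewrite nk mul2n.
split; first by apply: (simple_atom cm w0_max); rewrite -gb.
split.
  split; first by apply: (Hg (i := 1)); rewrite expg1.
  by move=> h /Hgen [i hi]; exists (Posz i).
split=> //; split=> //; split; first by apply/aevP; rewrite -/(f k) fE dE.
(* [B] commutes with its power [Delta], so it equals its own bar. *)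
apply/aevP; rewrite /bar !aev_cat -aev_inv dE -gb -gk.
by rewrite mulgA -expgSr expgS mulgK.
Qed.

Lemma dbar_le1 (b : A) : le 1 b -> le 1 (dbar b).
Proof.
move=> [h ->]; have [k E] := Dlt_mul cm w0_max h; exists k.
by rewrite !mul1g dbar_def -iotaM E iotaM mulgK.
Qed.

Lemma altg_le (b : A) i j : le 1 b -> i <= j ->
  le (altg b (dbar b) i) (altg b (dbar b) j).
Proof.
move=> b1 /subnK <-; elim: (j - i) => [|k IH]; first exact: le_refl.
apply: le_trans IH _; rewrite addSn /altg alt_rcons foldr_rcons.
have fr (x : A) s : foldr mul x s = foldr mul 1 s * x.
  by elim: s => [|y s IH]; rewrite /= ?mul1g // IH mulgA.
rewrite mulg1 [X in le _ X]fr -{1}(mulg1 (foldr _ _ _)) le_mull.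
by case: (odd _) => //; apply: dbar_le1.
Qed.

Lemma deg_altg (b : A) i : deg (altg b (dbar b) i) = (Posz i * deg b)%R.
Proof.
elim: i => [|i IH]; first by rewrite deg1 GRing.mul0r.
rewrite (altgS cm w0_max) degM dbar_def !degM degV IH; lia.
Qed.

Lemma finite_subgroup_type2 j b : n = j.*2.+1 ->
    ((0 < deg delta)%R \/ n = 1%N) ->
    b * delta = g ^+ j.+1 -> le 1 b -> altg b (dbar b) n = delta ->
  concl (fun sigma => type2 m d H sigma n).
Proof.
move=> nj d0 bd b1 bn; have [B BE] := aev_surj b.
pose f i := altw B (bar d B) i.
have barE : aev (bar d B) = dbar b by rewrite /bar !aev_cat -aev_inv dE -BE mulgA.
have fE i : aev (f i) = altg b (dbar b) i.
  rewrite /f altwE /altg -barE BE; elim: i (B) (bar d B) => //= i IH x y.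
  by rewrite aev_cat IH.
have fd i : i <= n -> le (aev (f i)) delta.
  by move=> i_n; rewrite fE -bn; apply: altg_le.
have f_mono i k : i <= k < n -> le (aev (f i)) (aev (f k)).
  by move=> /andP[ik _]; rewrite !fE; apply: altg_le.
have gBd : aev (B ++ d) = g ^+ j.+1 by rewrite aev_cat -BE dE.
have BdE i : aev (wpow (B ++ d) (Posz i)) = g ^+ (j.+1 * i).
  by rewrite aev_wpow gBd expgnA.
have Hf i : H (wpow (B ++ d) (Posz i)) by apply: Hg (BdE i).
have Hgen h : H h -> exists i, Defs.geq m d h (wpow (B ++ d) (Posz i)).
  (* As [B Delta = g^(j+1)] and [2 (j+1) = n + 1], the power [2i] of [B Delta] is [g^i] times the
     central [g^(n i)]. *)
  move=> /gH [i [k E]]; exists (2 * i)%N; apply/(geqP cm w0_max dE).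
  exists (k + i), 0; rewrite BdE mulg1 expgnDr mulgA E -gn -expgnA -expgnDr.
  by congr (_ ^+ _); lia.
have gf i : i < n -> veq m d ((B ++ d) ++ f i) (f (i.+1 %% n)).
  move=> i_n; apply/(veqP dE); rewrite aev_cat fE aev_cat -BE dE.
  (* Moving [Delta] across the product bars it: [B Delta P_i = B (bar P_i) Delta = P_(i+1)
     Delta]. *)
  rewrite -mulgA -dbar_delta mulgA -(altgS cm w0_max).
  apply: eqpow_trans (eqpow_mul _ _) _; rewrite fE.
  have [lt|le] := ltnP i.+1 n; first by rewrite modn_small //; apply: eqpow_refl.
  have -> : i.+1 = n by lia.
  by rewrite modnn bn; have := eqpow_mul delta 1; rewrite mul1g.
have fd' i : i < n -> le (aev (f i)) delta by move=> /ltnW; apply: fd.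
have [si [st [inv [tr vert]]]] := orbit_simplex cm w0_max dE n_gt0 Hf Hgen (fE 0) fd' f_mono gf.
(* Here [(B Delta)^2 = B (bar B) Delta^2], and also [(B Delta)^2 = g^(2j+2) = g Delta^2]. *)
have BBE : aev (B ++ bar d B) = g.
  apply: (mulIg delta2); rewrite aev_cat barE -BE.
  have -> : b * dbar b * delta2 = (b * delta) * (b * delta).
    by rewrite dbar_def delta2_def !mulgA mulgVK.
  by rewrite bd -expgnDr -gn -expgS; congr (_ ^+ _); lia.
exists (mkseq f n); do 4 split=> //.
exists B; split; first by rewrite nj /= odd_double.
split.
  apply: (simple_atom cm w0_max); rewrite -BE //.
  have := fd 1%N n_gt0; rewrite fE /altg /= mulg1; exact.
split.
  split; first by apply: (Hg (i := j.+1)).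
  by move=> h /Hgen [i hi]; exists (Posz i).
split=> //; split.
  move=> i i_n; apply: (simple_atom cm w0_max); last exact: fd'.
  by rewrite -/(f i) fE; apply: (altg_le b1 (leq0n i)).
split.
  move=> i k i_n k_n ik /(veqP dE) [a [c]]; rewrite -/(f i) -/(f k) !fE.
  (* [P_i] has degree [i] times that of [b], and [Delta] has [n] times it, so equal vertices have
     indices congruent modulo [n]. When [n = 1] there is only one index. *)
  case: d0 => [d0|n1]; last by move: ik i_n k_n; rewrite n1; case: i k => [|i] [|k].
  move=> /(congr1 deg); rewrite !degM !degX !deg_altg -bn deg_altg => E.
  have db : (0 < deg b)%R by move: d0; rewrite -bn deg_altg; nia.
  have E' : i + a * n = k + c * n by nia.
  have := congr1 (modn^~ n) E'.
  by rewrite /= !(addnC _ (_ * n)%N) !modnMDl !modn_small // => /eqP; rewrite (negbTE ik).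
split=> //; split; first by apply/aevP; rewrite -/(f n) fE dE.
split; first by apply: (Hg (i := 1)); rewrite BBE.
move=> h /gH [i [k E]]; exists (Posz i); apply/(geqP cm w0_max dE).
by rewrite aev_wpow BBE -E; apply/eqpow_sym/eqpow_mulX.
Qed.

End FiniteSubgroupTypes.

(** * The preimage of a finite subgroup, its generator and the conjugation *)

Theorem theorem4p6 (S : finType) (m : S -> S -> nat) (d : word S)
  (H : word S -> Prop) :
  coxeter_matrix m -> finite_type m -> is_Delta m d ->
  subgroupG m d H -> finite_subgroup m d H ->
  cyclicG m d H /\
  exists (c : word S) (sigma : seq (word S)) (n : nat),
    let H' := conjG c H in
    has_order m d H n /\
    simplex m d sigma /\
    (exists2 v, v \in sigma & veq m d v [::]) /\
    (forall h v, H' h -> v \in sigma -> exists2 w, w \in sigma & veq m d (h ++ v) w) /\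
    (forall v w, v \in sigma -> w \in sigma -> exists h, H' h /\ veq m d (h ++ v) w) /\
    (type1 m d H' sigma n \/ type2 m d H' sigma n).
Proof.
move=> cm _ [w [pw [/aevP dw [/cox_lengthP wlw w_max]]]] [Hgeq [H1 [HM HV]]].
move=> [n' [L [_ [_ [_ Lall]]]]].
pose w0 := wev m (map fst w).
have w0_max (a : cox_grp m) : wlen a <= wlen w0.
  have [r [rr <-]] := reduced_ex a; rewrite /w0 wlw.
  by apply: (w_max (emb r)); apply/cox_lengthP; rewrite map_fst_emb.
have dE : aev m d = delta w0.
  rewrite dw /delta /Dlt mlift_reduced // ?iota_mev ?emb_map_fst //.
  by rewrite /reduced wlw size_map.
have gP := geqP cm w0_max dE.
pose K (x : artin_grp m) := exists2 v, H v & aev m v = x.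
have HK v : H v <-> K (aev m v).
  split=> [Hv|[u Hu /aevP uv]]; first by exists v.
  exact/(Hgeq u)/geq_aeq.
have K1 : K 1 by exists [::].
have KM x y : K x -> K y -> K (x * y).
  by move=> [u Hu <-] [v Hv <-]; exists (u ++ v); [apply: HM | rewrite aev_cat].
have KV x : K x -> K x^-1.
  by move=> [u Hu <-]; exists (winv u); [apply: HV | rewrite aev_inv].
have Kd : K (delta2 w0).
  exists (d ++ d); last by rewrite aev_cat dE.
  apply: Hgeq H1 _; apply/gP; exists 1%N, 0; rewrite aev_cat dE mul1g mulg1; exact: expg1.
have Kfin x : K x -> exists2 y, y \in map (aev m) L & eqpow (delta2 w0) x y.
  move=> [u /Lall [v vL /gP uv] <-]; exists (aev m v) => //.
  exact: map_f.
have [g [n [n0 [Kg gn gK d0 g_inj]]]] := fin_cyclic cm w0_max K1 KM KV Kd Kfin.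
have [a aE] := aev_surj g.
have HaX i : H (wpow a (Posz i)).
  by apply/HK; rewrite aev_wpow -aE; apply: KX.
have Hgen h : H h -> exists i, Defs.geq m d h (wpow a (Posz i)).
  move=> /HK/gK [i [j E]]; exists i; apply/gP.
  by rewrite aev_wpow -aE -E; apply/eqpow_sym/eqpow_mulX.
(* The order is read off from the generator: its powers below [n] represent [H] without
   repetition. *)
have ord : has_order m d H n.
  exists (mkseq (fun i => wpow a (Posz i)) n); split; first by rewrite size_mkseq.
  split; first by move=> _ /mapP[i _ ->].
  split.
    move=> i j i_n j_n ij; rewrite !nth_mkseq // => /gP; rewrite !aev_wpow -aE.
    by move/(g_inj _ _ i_n j_n)/eqP; apply/negP.
  move=> h /Hgen [i hi]; exists (wpow a (Posz (i %% n))).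
    by apply/mapP; exists (i %% n); rewrite ?mem_iota ?ltn_pmod.
  apply: cong_trans hi _; apply/gP; rewrite !aev_wpow -aE.
  exists 0, (i %/ n); rewrite mulg1 -gn -expgnA -expgnDr addnC mulnC.
  by rewrite -divn_eq.
split.
  exists a; split; first by apply/HK; rewrite -aE.
  by move=> h /Hgen [i hi]; exists (Posz i).
(* [conjG c H] is [c H c^-1]; with [c = y^-1] its preimage is generated by [y^-1 g y]. *)
have conjP y c : aev m c = y^-1 ->
  (forall u i, aev m u = (y^-1 * g * y) ^+ i -> conjG c H u) /\
  (forall h, conjG c H h ->
     exists i j, aev m h * delta2 w0 ^+ j = (y^-1 * g * y) ^+ i).
  move=> cy; have cE u : aev m (winv c ++ u ++ c) = y * aev m u * y^-1.
    by rewrite !aev_cat -aev_inv cy invgK mulgA.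
  split=> [u i ui|h].
    apply/HK; rewrite cE ui conj_expg !mulgA mulgV mul1g mulgK.
    exact: KX.
  move/HK; rewrite cE => /gK [i [j E]]; exists i, j; rewrite conj_expg -E.
  by rewrite -!mulgA -(commuteX _ (delta2C cm w0_max y)) !mulgA mulVg mul1g mulgVK.
have conj_gn y : (y^-1 * g * y) ^+ n = delta2 w0.
  by rewrite conj_expg gn -mulgA -(delta2C cm w0_max y) mulKg.
have [n_odd|n_even] := boolP (odd n).
  have nj : n = n./2.*2.+1 by rewrite -{1}(odd_double_half n) n_odd.
  have [y [b1 bn]] := root_odd cm w0_max (g := g) (j := n./2) (etrans (congr1 _ (esym nj)) gn).
  have [c cE] := aev_surj y^-1; have [Hg gH] := conjP y c (esym cE).
  have [||sigma sP] := finite_subgroup_type2 cm w0_max dE n0 Hg gH (conj_gn y) nj d0 _ b1.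
  - by rewrite mulgVK conj_expg.
  - by move: bn; rewrite -nj.
  by exists c, sigma, n; case: sP => si [st [inv [tr ty]]]; do ! split=> //; right.
have nk : n = n./2.*2 by rewrite -{1}(odd_double_half n) (negbTE n_even).
have k0 : 0 < n./2 by rewrite -double_gt0 -nk.
have [y [yk y1]] := root_even cm w0_max k0 (etrans (congr1 _ (esym nk)) gn).
have [c cE] := aev_surj y^-1; have [Hg gH] := conjP y c (esym cE).
have [sigma [si [st [inv [tr ty]]]]] := finite_subgroup_type1 cm w0_max dE n0 Hg gH nk yk y1.
by exists c, sigma, n; do ! split=> //; left.
Qed.
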